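(* Let $\theta\in\mathbb Z$, $0\le r_1<1<r_2\le\infty$, let $\alpha_+(t)=\sum_{k\ge 0}\alpha_k t^k$ be analytic in $|t|<r_2$ and $\beta_-(t)=\sum_{k\le -1}\beta_k t^k$ be analytic in $|t|>r_1$ (vanishing at $\infty$), and let $$a(t)=\begin{pmatrix}1&\beta_-(t)\\ \alpha_+(t)& t^\theta+\alpha_+(t)\beta_-(t)\end{pmatrix}.$$ For $N\in\mathbb N$ let $a_N(t)$ be the Laurent matrix polynomial obtained from $a(t)$ by replacing $\alpha_+$ by $\alpha_+^{(N)}(t)=\sum_{k=0}^N\alpha_kt^k$ and $\beta_-$ by $\beta_-^{(N)}(t)=\sum_{k=-N}^{-1}\beta_kt^k$. Suppose that for at least one $N$ and one admissible pair $(\zeta_1,\zeta_2)$ the following two conditions are fulfilled: 1. $a_N(t)$ admits a stable $P$-normalised factorisation $a_N(t)=a_-^{(N)}(t)d_r(t)a_+^{(N)}(t)$ for some $P\in\{I_2,J_2\}$; 2. $q_N(\zeta_1,\zeta_2)<1$, where $$q_N(\zeta_1,\zeta_2)=\sigma\,\delta_N(\zeta_1,\zeta_2)\,\bigl\|\bigl(a_+^{(N)}\bigr)^{-1}\bigr\|_W\,\bigl\|\bigl(a_-^{(N)}\bigr)^{-1}\bigr\|_W .$$ Then $a(t)$ admits a stable factorisation with the same set of partial indices as $a_N(t)$.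
   Context: Wiener algebra. $W^{p\times p}$ is the algebra of $p\times p$ matrix functions $A(t)=\sum_{k\in\mathbb Z}A_kt^k$ on the unit circle $\mathbb T$ with $\|A\|_W=\sum_k\|A_k\|_1<\infty$, where $\|\cdot\|_1$ is the maximum column sum matrix norm. $W_+^{p\times p}$ (resp. $W_-^{p\times p}$) is the subalgebra of those with $A_k=0$ for $k<0$ (resp. $k>0$). Factorisation. A (right Wiener–Hopf) factorisation of an invertible $a\in W^{2\times2}$ is $a(t)=a_-(t)d_r(t)a_+(t)$, $t\in\mathbb T$, where $a_\pm\in W_\pm^{2\times2}$ is invertible in $W_\pm^{2\times 2}$ and $d_r(t)=\mathrm{diag}[t^{\rho_1},t^{\rho_2}]$ with integers $\rho_1\le\rho_2$ (the right partial indices, uniquely determined by $a$). The factorisation is stable if $\rho_2-\rho_1\le 1$. For the matrix functions $a$ and $a_N$ here the determinant is $t^\theta$, so $\rho_1+\rho_2=\theta$, and stability means: $\rho_1=\rho_2=\nu$ if $\theta=2\nu$; $\rho_1=\nu,\ \rho_2=\nu+1$ if $\theta=2\nu+1$. $P$-normalisation of a stable factorisation. Let $J_2=\begin{pmatrix}0&1\\1&0\end{pmatrix}$. If $\rho_1=\rho_2$, normalised means $a_-(\infty)=I_2$. If $\rho_2=\rho_1+1$, write $a_-(t)=C_0+C_1t^{-1}+\cdots$; the factorisation is $I_2$-normalised if $C_0$ is lower triangular with unit diagonal and $(C_1)_{12}=0$; it is $J_2$-normalised if $J_2C_0$ is lower triangular with unit diagonal and $(J_2C_1)_{12}=0$.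 A $P$-normalised factorisation, when it exists, is unique. Admissible pairs and $\delta_N$. A pair $(\zeta_1,\zeta_2)$ is admissible if $r_1<\zeta_1<1$ and $1<\zeta_2<r_2$; in addition $\zeta_1=r_1$ is allowed if $r_1>0$ and $\beta_-$ extends continuously to $|t|=r_1$, and $\zeta_2=r_2$ is allowed if $r_2<\infty$ and $\alpha_+$ extends continuously to $|t|=r_2$. Put $M_+(\zeta_2)=\max_{|t|=\zeta_2}|\alpha_+(t)|$, $M_-(\zeta_1)=\max_{|t|=\zeta_1}|\beta_-(t)|$ and $$\delta_N(\zeta_1,\zeta_2)=\Bigl(1+\frac{\zeta_2M_+(\zeta_2)}{\zeta_2-1}\Bigr)\frac{\zeta_1^{N+1}M_-(\zeta_1)}{1-\zeta_1}+\Bigl(1+\frac{\zeta_1M_-(\zeta_1)}{1-\zeta_1}\Bigr)\frac{M_+(\zeta_2)}{\zeta_2^N(\zeta_2-1)}.$$ Constant $\sigma$: $\sigma=\|d_r\|_W=\|d_r^{-1}\|_W$, i.e. $\sigma=1$ if $\theta$ is even and $\sigma=2$ if $\theta$ is odd. *)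

(* Defs.v *)
From HB Require Import structures.
From mathcomp Require Import all_boot all_order all_algebra.
From mathcomp Require Import complex.
From mathcomp Require Import all_classical all_reals all_analysis.
Set Implicit Arguments.
Unset Strict Implicit.
Unset Printing Implicit Defensive.
Import Order.TTheory GRing.Theory Num.Theory.
Import numFieldNormedType.Exports.
Local Open Scope classical_set_scope.
Local Open Scope ring_scope.
Local Open Scope complex_scope.

(* The complex plane is R[i]; its topology is the one carried
   by the alias R[i]^o, used only where limits are taken. *)

Definition cmod (R : realType) (z : R[i]) : R := complex.Re `|z|.

(* Both halves of a two-sided series take the coefficients c_k, k : int, of the
   whole series: [plus_terms] only sees k >= 0, [minus_terms] only k <= -1. *)
Definition plus_terms (R : realType) (c : int -> R[i]) (t : R[i]) (k : nat) :
    R[i]^o := c k%:Z * t ^ k%:Z.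

Definition minus_terms (R : realType) (c : int -> R[i]) (t : R[i]) (k : nat) :
    R[i]^o := c (- k.+1%:Z) * t ^ (- k.+1%:Z).

Definition plus_fun (R : realType) (c : int -> R[i]) (t : R[i]) : R[i] :=
  limn (series (plus_terms c t)).

Definition minus_fun (R : realType) (c : int -> R[i]) (t : R[i]) : R[i] :=
  limn (series (minus_terms c t)).

Definition plus_trunc (R : realType) (N : nat) (c : int -> R[i]) (t : R[i]) :
  R[i] := \sum_(k < N.+1) c k%:Z * t ^ k%:Z.

Definition minus_trunc (R : realType) (N : nat) (c : int -> R[i]) (t : R[i]) :
  R[i] := \sum_(k < N) c (- k.+1%:Z) * t ^ (- k.+1%:Z).

Definition disc (R : realType) (r2 : \bar R) : set R[i] :=
  [set t | ((cmod t)%:E < r2)%E].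

Definition closed_disc (R : realType) (r2 : \bar R) : set R[i] :=
  [set t | ((cmod t)%:E <= r2)%E].

Definition exterior (R : realType) (r1 : R) : set R[i] := [set t | r1 < cmod t].

Definition closed_exterior (R : realType) (r1 : R) : set R[i] :=
  [set t | r1 <= cmod t].

(* c_0 + c_1 t + c_2 t^2 + ... is analytic in |t| < r2. *)
Definition analytic_plus (R : realType) (r2 : \bar R) (c : int -> R[i]) :=
  forall t, disc r2 t -> cvgn (series (plus_terms c t)).

(* c_{-1} t^{-1} + c_{-2} t^{-2} + ... is analytic in |t| > r1. *)
Definition analytic_minus (R : realType) (r1 : R) (c : int -> R[i]) :=
  forall t, exterior r1 t -> cvgn (series (minus_terms c t)).

Definition norm1 (R : realType) (p : nat) (A : 'M[R[i]]_p) : R :=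
  \big[Num.max/0]_(j < p) \sum_(i < p) cmod (A i j).

Definition coef_norm (R : realType) (p : nat) (c : int -> 'M[R[i]]_p) : \bar R :=
  (\esum_(k in [set: int]) (norm1 (c k))%:E)%E.

(* An element of the Wiener algebra is given by its coefficients; the matrix
   function on the unit circle which it represents is [weval]. *)
Record wiener (R : realType) (p : nat) := Wiener {
  wcoef : int -> 'M[R[i]]_p;
  wcoef_summable : (coef_norm wcoef < +oo)%E }.

Definition wnorm (R : realType) (p : nat) (A : wiener R p) : R :=
  fine (coef_norm (wcoef A)).

Definition weval (R : realType) (p : nat) (A : wiener R p) (t : R[i]) :
    'M[R[i]]_p :=
  \matrix_(i, j) (plus_fun (fun k => wcoef A k i j) t
                  + minus_fun (fun k => wcoef A k i j) t).

Definition wplus (R : realType) (p : nat) (A : wiener R p) :=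
  forall k : int, k < 0 -> wcoef A k = 0.

Definition wminus (R : realType) (p : nat) (A : wiener R p) :=
  forall k : int, 0 < k -> wcoef A k = 0.

(* Coefficients are determined by the function on the circle, hence so is the
   inverse B of A. *)
Definition winverse (R : realType) (p : nat) (A B : wiener R p) :=
  forall t, cmod t = 1 -> weval A t *m weval B t = 1%:M.

Definition mx2 (R : realType) (a b c d : R[i]) : 'M[R[i]]_2 :=
  \matrix_(i, j) (if i == 0 then if j == 0 then a else b
                  else if j == 0 then c else d).

Definition J2 (R : realType) : 'M[R[i]]_2 := mx2 0 1 1 0.

Definition dr (R : realType) (rho1 rho2 : int) (t : R[i]) : 'M[R[i]]_2 :=
  mx2 (t ^ rho1) 0 0 (t ^ rho2).

Definition dr_coef (R : realType) (rho1 rho2 k : int) : 'M[R[i]]_2 :=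
  mx2 (k == rho1)%:R 0 0 (k == rho2)%:R.

(* sigma = ||d_r||_W, computed in [sigmaE] below. *)
Definition sigma (R : realType) (rho1 rho2 : int) : R :=
  fine (coef_norm (@dr_coef R rho1 rho2)).

Lemma cmod_nat (R : realType) (b : bool) : cmod (b%:R : R[i]) = b%:R.
Proof. by rewrite /cmod; case: b; rewrite ?normr0 ?normr1. Qed.
Lemma norm1_dr (R : realType) (rho1 rho2 k : int) :
  norm1 (@dr_coef R rho1 rho2 k) = ((k == rho1) || (k == rho2))%:R.
Proof.
rewrite /norm1 !big_ord_recl !big_ord0 !mxE /=.
have c0 : cmod (0 : R[i]) = 0 by rewrite /cmod normr0.
rewrite c0 !cmod_nat !addr0 add0r.
case: (k == rho1); case: (k == rho2);
  rewrite /= ?maxxx ?(max_l ler01) ?(max_r ler01) ?maxxx ?(max_l ler01) //.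
Qed.
Lemma sigmaE (R : realType) (rho1 rho2 : int) :
  sigma R rho1 rho2 = if rho1 == rho2 then 1 else 2.
Proof.
rewrite /sigma /coef_norm.
under eq_esum do rewrite norm1_dr.
rewrite (_ : (\esum_(k in [set: int]) _)%E =
   (\esum_(k in [set rho1; rho2]) 1%:E)%E :> \bar R); last first.
  rewrite [RHS]esum_mkcond; apply: eq_esum => k _.
  rewrite in_setU !in_set1.
  by case: (_ || _).
have [->|ne] := eqVneq rho1 rho2; first by rewrite setUid esum_set1.
rewrite esum_fset; [|exact: finite_set2|by []].
by rewrite fsbigU0 ?fsbig_set1 //= => k [-> /= e]; move: ne; rewrite e eqxx.
Qed.

Definition wh_factorisation (R : realType) (a : R[i] -> 'M[R[i]]_2)
    (am : wiener R 2) (rho1 rho2 : int) (ap : wiener R 2) :=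
  [/\ wminus am /\ (exists2 bm, wminus bm & winverse am bm),
      wplus ap /\ (exists2 bp, wplus bp & winverse ap bp),
      rho1 <= rho2 &
      forall t, cmod t = 1 ->
        a t = weval am t *m dr rho1 rho2 t *m weval ap t].

Definition stable (rho1 rho2 : int) : Prop := rho2 - rho1 <= 1.

(* [is_trig_mx] is lower triangularity. *)
Definition unit_lower_trig (R : realType) (A : 'M[R[i]]_2) : Prop :=
  is_trig_mx A /\ forall i, A i i = 1.

Definition normalised (R : realType) (P : 'M[R[i]]_2) (rho1 rho2 : int)
    (am : wiener R 2) :=
  (rho1 = rho2 -> wcoef am 0 = 1%:M) /\
  (rho2 = rho1 + 1 ->
     unit_lower_trig (P *m wcoef am 0) /\ (P *m wcoef am (-1)) 0 1 = 0).

Definition matrix_a (R : realType) (theta : int) (f g : R[i] -> R[i])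
    (t : R[i]) : 'M[R[i]]_2 :=
  mx2 1 (g t) (f t) (t ^ theta + f t * g t).

Definition extends_continuously (R : realType) (f : R[i] -> R[i])
    (D K : set R[i]) :=
  exists g : R[i]^o -> R[i]^o,
    {within (K : set R[i]^o), continuous g} /\ forall t, D t -> g t = f t.

(* The value at t of the continuous extension of f from D, if there is one. *)
Definition extension (R : realType) (f : R[i] -> R[i]) (D : set R[i])
    (t : R[i]) : R[i] :=
  if t \in D then f t
  else lim ((f s : R[i]^o) @[s --> within D (nbhs (t : R[i]^o))]).

Definition circle_max (R : realType) (f : R[i] -> R[i]) (zeta : R) : R :=
  sup [set cmod (f t) | t in [set t | cmod t = zeta]].

Definition Mplus (R : realType) (r2 : \bar R) (alpha : int -> R[i]) : R -> R :=
  circle_max (extension (plus_fun alpha) (disc r2)).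

Definition Mminus (R : realType) (r1 : R) (beta : int -> R[i]) : R -> R :=
  circle_max (extension (minus_fun beta) (exterior r1)).

Definition admissible (R : realType) (r1 : R) (r2 : \bar R)
    (alpha beta : int -> R[i]) (zeta1 zeta2 : R) :=
  (r1 < zeta1 < 1 \/
   [/\ zeta1 = r1, 0 < r1 &
       extends_continuously (minus_fun beta) (exterior r1) (closed_exterior r1)])
  /\
  ((1 < zeta2 /\ (zeta2%:E < r2)%E) \/
   zeta2%:E = r2 /\
   extends_continuously (plus_fun alpha) (disc r2) (closed_disc r2)).

Definition delta (R : realType) (r1 : R) (r2 : \bar R)
    (alpha beta : int -> R[i]) (N : nat) (zeta1 zeta2 : R) : R :=
  let Mp := Mplus r2 alpha zeta2 in
  let Mm := Mminus r1 beta zeta1 in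
  (1 + zeta2 * Mp / (zeta2 - 1)) * (zeta1 ^+ N.+1 * Mm / (1 - zeta1))
  + (1 + zeta1 * Mm / (1 - zeta1)) * (Mp / (zeta2 ^+ N * (zeta2 - 1))).

(* Main.v *)
Require Import Defs.
From HB Require Import structures.
From mathcomp Require Import all_boot all_order all_algebra.
From mathcomp Require Import complex.
From mathcomp Require Import all_classical all_reals all_analysis.
From mathcomp Require Import cyclic separable cyclotomic.
From mathcomp Require Import ring lra zify.
Set Implicit Arguments.
Unset Strict Implicit.
Unset Printing Implicit Defensive.
Import Order.TTheory GRing.Theory Num.Theory.
Import numFieldNormedType.Exports.
Local Open Scope classical_set_scope.
Local Open Scope ring_scope.
Local Open Scope complex_scope.

(** Write [D] for [d_r]. The Cauchy estimates for the coefficients of [alpha_+]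
    and [beta_-] bound the tails of the two series by geometric ones and give
    [||a - a_N|| <= delta_N], so that
    [X = D^-1 (a_-^(N))^-1 (a - a_N) (a_+^(N))^-1] has norm less than 1 and
    [a = a_-^(N) D (1 + X) a_+^(N)].

    Since [||X|| < 1], the equations [Y + P_+(X Y) = 1] and [V + P_-(V X) = 1],
    where [P_+] and [P_-] keep the coefficients [k >= 0] and [k < 0], are solved
    by Neumann series. With [U = (1 + X) Y] and [T = V (1 + X)] one has
    [V U = T Y], where [V U - 1] has only coefficients [k < 0] and [T Y] only
    [k >= 0]; hence both products are 1 and [1 + X = U T]. Finally
    [D (1 + X) = (D U D^-1) D T], and stability makes [D U D^-1] an element of
    [W_-]: conjugation by [D] shifts the off-diagonal entries of [U], whose
    coefficients live in [k <= -1], by at most one. *)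

Section Modulus.
Variable R : realType.
Implicit Types x y z : R[i].

Lemma cmod_normc z : cmod z = Normc.normc z. Proof. by []. Qed.

Lemma normC_cmod z : `|z| = (cmod z)%:C. Proof. by []. Qed.

Lemma cmod_ge0 z : 0 <= cmod z.
Proof. by rewrite -ler0c -normC_cmod. Qed.

Lemma cmod0 : cmod (0 : R[i]) = 0.
Proof. by rewrite cmod_normc Normc.normc0. Qed.

Lemma cmod1 : cmod (1 : R[i]) = 1.
Proof. by rewrite cmod_normc Normc.normc1. Qed.

Lemma cmodM : {morph @cmod R : x y / x * y}.
Proof. exact: Normc.normcM. Qed.

Lemma cmodD x y : cmod (x + y) <= cmod x + cmod y.
Proof. exact: le_normcD. Qed.

Lemma cmodN x : cmod (- x) = cmod x.
Proof. exact: normcN. Qed.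

Lemma cmod_distC x y : cmod (x - y) = cmod (y - x).
Proof. by rewrite -cmodN opprB. Qed.

Lemma cmod_eq0 x : (cmod x == 0) = (x == 0).
Proof. by apply/eqP/eqP => [/Normc.eq0_normc//|->]; rewrite cmod0. Qed.

Lemma cmodV x : cmod x^-1 = (cmod x)^-1.
Proof. exact: Normc.normcV. Qed.

Lemma cmodX x n : cmod (x ^+ n) = cmod x ^+ n.
Proof. by elim: n => [|n ih]; rewrite ?cmod1// !exprS cmodM ih. Qed.

Lemma cmodXz x (k : int) : cmod (x ^ k) = cmod x ^ k.
Proof. by case: k => n; rewrite /exprz ?cmodV cmodX. Qed.

Lemma cmod_real (r : R) : cmod r%:C = `|r|.
Proof. by rewrite cmod_normc/= expr0n addr0 sqrtr_sqr. Qed.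

Lemma cmod_natr n : cmod (n%:R : R[i]) = n%:R.
Proof. by rewrite -(rmorph_nat (real_complex R)) cmod_real ger0_norm. Qed.

Lemma cmod_sum (I : Type) (s : seq I) (P : pred I) (F : I -> R[i]) :
  cmod (\sum_(i <- s | P i) F i) <= \sum_(i <- s | P i) cmod (F i).
Proof.
elim/big_rec2: _ => [|i u v _ uv]; first by rewrite cmod0.
by rewrite (le_trans (cmodD _ _))// lerD2l.
Qed.

Lemma cmod_dist x y : `|cmod x - cmod y| <= cmod (x - y).
Proof. exact: (@ler_dist_dist R (Rcomplex R) x y). Qed.

Lemma normr_Re_le_cmod z : `|complex.Re z| <= cmod z.
Proof. by rewrite -lecR -normC_cmod normc_ge_Re. Qed.

Lemma cmod_i : cmod ('i%C : R[i]) = 1.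
Proof. by rewrite cmod_normc/= expr0n expr1n add0r sqrtr1. Qed.

Lemma normr_Im_le_cmod z : `|complex.Im z| <= cmod z.
Proof.
have := normr_Re_le_cmod (z * 'i%C).
by rewrite ReiNIm normrN cmodM cmod_i mulr1.
Qed.

End Modulus.

(** * Unconditional sums *)

Section NonnegativeSums.
Variable R : realType.

Lemma esumZl (T : choiceType) (D : set T) (c : R) (f : T -> \bar R) : 0 <= c ->
  (forall i, 0 <= f i)%E ->
  (\esum_(i in D) (c%:E * f i) = c%:E * \esum_(i in D) f i)%E.
Proof.
move=> c0 f0; rewrite /esum -ereal_supZl//; last first.
  apply/set0P; exists (\sum_(i \in set0) f i)%E; exists set0 => //.
  by split.
congr (ereal_sup _); rewrite image_comp; apply: eq_imagel => A _ /=.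
by rewrite -ge0_mule_fsumr.
Qed.

Lemma reindex_esum_inj (T U : choiceType) (e : U -> T) (f : T -> \bar R) :
  injective e -> (forall k, ~ range e k -> f k = 0%E) ->
  (\esum_(k in [set: T]) f k = \esum_(i in [set: U]) f (e i))%E.
Proof.
move=> inje f0; rewrite -(esum_image setT e); last first.
  by move=> i j _ _; exact: inje.
rewrite [RHS]esum_mkcond; apply: eq_esum => k _.
by case: ifPn => // /negP; rewrite inE => /f0.
Qed.

(* For nonnegative families; [nsum f] is 0 when [f] is not summable. *)
Definition nsummable (T : choiceType) (f : T -> R) :=
  (\esum_(i in [set: T]) (f i)%:E < +oo)%E.

Definition nsum (T : choiceType) (f : T -> R) : R :=
  fine (\esum_(i in [set: T]) (f i)%:E)%E.

Section Theory.
Variable T : choiceType.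
Implicit Types f g : T -> R.

Lemma esum_nsum f : (forall i, 0 <= f i) -> nsummable f ->
  (\esum_(i in [set: T]) (f i)%:E)%E = (nsum f)%:E.
Proof.
move=> f0 fs; rewrite /nsum fineK// ge0_fin_numE//.
by apply: esum_ge0 => i _; rewrite lee_fin.
Qed.

Lemma nsum_ge0 f : (forall i, 0 <= f i) -> 0 <= nsum f.
Proof. by move=> f0; apply/fine_ge0/esum_ge0 => i _; rewrite lee_fin. Qed.

Lemma nsummable_le f g : (forall i, f i <= g i) -> nsummable g -> nsummable f.
Proof.
by move=> fg; apply: le_lt_trans; apply: le_esum => i _; rewrite lee_fin.
Qed.

Lemma esum_le_nsummable f (M : R) :
  (\esum_(i in [set: T]) (f i)%:E <= M%:E)%E -> nsummable f.
Proof. by move=> fM; rewrite /nsummable (le_lt_trans fM)// ltry. Qed.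

Lemma esum_le_nsum f (M : R) : (forall i, 0 <= f i) ->
  (\esum_(i in [set: T]) (f i)%:E <= M%:E)%E -> nsum f <= M.
Proof.
by move=> f0 fM; rewrite -lee_fin -esum_nsum//; exact: esum_le_nsummable fM.
Qed.

Lemma le_nsum f g : (forall i, 0 <= f i) -> (forall i, f i <= g i) ->
  nsummable g -> nsum f <= nsum g.
Proof.
move=> f0 fg gs; apply: esum_le_nsum => //.
rewrite -esum_nsum//; last by move=> i; exact: le_trans (fg i).
by apply: le_esum => i _; rewrite lee_fin.
Qed.

Lemma nsum0 : nsum (fun _ : T => 0) = 0.
Proof. by rewrite /nsum esum1. Qed.

Lemma esum_EFinD f g : (forall i, 0 <= f i) -> (forall i, 0 <= g i) ->
  (\esum_(i in [set: T]) (f i + g i)%:E =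
   \esum_(i in [set: T]) (f i)%:E + \esum_(i in [set: T]) (g i)%:E)%E.
Proof. by move=> f0 g0; rewrite -esumD// => i _; rewrite lee_fin. Qed.

Lemma nsummableD f g : (forall i, 0 <= f i) -> (forall i, 0 <= g i) ->
  nsummable f -> nsummable g -> nsummable (fun i => f i + g i).
Proof.
by move=> f0 g0 fs gs; rewrite /nsummable esum_EFinD// lte_add_pinfty.
Qed.

Lemma nsumD f g : (forall i, 0 <= f i) -> (forall i, 0 <= g i) ->
  nsummable f -> nsummable g -> nsum (fun i => f i + g i) = nsum f + nsum g.
Proof.
by move=> f0 g0 fs gs; rewrite {1}/nsum esum_EFinD// !esum_nsum.
Qed.

Lemma nsummable_sum (I : Type) (s : seq I) (F : I -> T -> R) :
  (forall i k, 0 <= F i k) -> (forall i, nsummable (F i)) ->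
  nsummable (fun k => \sum_(i <- s) F i k).
Proof.
move=> F0 Fs; elim: s => [|i s ih].
  by rewrite /nsummable esum1 ?ltry// => k _; rewrite big_nil.
under eq_fun do rewrite big_cons; apply: nsummableD => // k.
by apply: sumr_ge0 => j _.
Qed.

Lemma nsum_sum (I : Type) (s : seq I) (F : I -> T -> R) :
  (forall i k, 0 <= F i k) -> (forall i, nsummable (F i)) ->
  nsum (fun k => \sum_(i <- s) F i k) = \sum_(i <- s) nsum (F i).
Proof.
move=> F0 Fs; elim: s => [|i s ih].
  by under eq_fun do rewrite big_nil; rewrite nsum0 big_nil.
under eq_fun do rewrite big_cons; rewrite nsumD// ?ih ?big_cons//.
  by move=> k; apply: sumr_ge0 => j _.
exact: nsummable_sum.
Qed.

Lemma nsummableZ (c : R) f : 0 <= c -> (forall i, 0 <= f i) -> nsummable f ->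
  nsummable (fun i => c * f i).
Proof.
move=> c0 f0 fs; rewrite /nsummable; under eq_esum do rewrite EFinM.
by rewrite esumZl// ?esum_nsum// -EFinM ltry.
Qed.

Lemma nsumZ (c : R) f : 0 <= c -> (forall i, 0 <= f i) -> nsummable f ->
  nsum (fun i => c * f i) = c * nsum f.
Proof.
move=> c0 f0 fs; rewrite {1}/nsum; under eq_esum do rewrite EFinM.
by rewrite esumZl// esum_nsum.
Qed.

Lemma nsum_cofinite_small f (eps : R) : (forall i, 0 <= f i) -> nsummable f ->
  0 < eps -> exists2 A : set T, finite_set A &
    nsum (fun i => if i \in A then 0 else f i) <= eps.
Proof.
move=> f0 fs e0.
have : ((nsum f - eps)%:E < \esum_(i in [set: T]) (f i)%:E)%E.
  by rewrite esum_nsum// lte_fin ltrBlDr ltrDl.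
move/ereal_sup_gt => [_ [A [finA _]] <-] fA_gt; exists A => //.
pose p i := if i \in A then f i else 0; pose q i := if i \in A then 0 else f i.
have p0 i : 0 <= p i by rewrite /p; case: ifP.
have q0 i : 0 <= q i by rewrite /q; case: ifP.
have ps : nsummable p by apply: nsummable_le fs => i; rewrite /p; case: ifP.
have qs : nsummable q by apply: nsummable_le fs => i; rewrite /q; case: ifP.
have fE : nsum f = nsum p + nsum q.
  rewrite -nsumD//; congr nsum; apply/funext => i.
  by rewrite /p /q; case: ifP; rewrite ?addr0 ?add0r.
have : nsum f - eps < nsum p.
  rewrite -lte_fin -esum_nsum// (lt_le_trans fA_gt)//.
  rewrite -esum_fset//; last by move=> i _; rewrite lee_fin.
  rewrite esum_mkcond; apply: le_esum => i _.
  by rewrite /p; case: ifP.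
rewrite -/q; lra.
Qed.

End Theory.

Lemma esum_unit (f : unit -> \bar R) : (0 <= f tt)%E ->
  (\esum_(i in [set: unit]) f i = f tt)%E.
Proof. by move=> f0; rewrite setT_unit esum_set1. Qed.

Lemma nsum_unit (f : unit -> R) : (forall i, 0 <= f i) -> nsum f = f tt.
Proof. by move=> f0; rewrite /nsum esum_unit// lee_fin. Qed.

Section Injections.
Variables (T U : choiceType) (e : U -> T).
Hypothesis inje : injective e.
Implicit Types f : T -> R.

Lemma reindex_nsum_inj f :
  (forall k, ~ range e k -> f k = 0) -> nsum f = nsum (fun i => f (e i)).
Proof. by move=> f0; congr fine; apply: reindex_esum_inj => // k /f0 ->. Qed.

Lemma nsummable_reindex_inj f :
  (forall k, ~ range e k -> f k = 0) ->
  nsummable (fun i => f (e i)) -> nsummable f.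
Proof.
by move=> f0; rewrite /nsummable (reindex_esum_inj inje)// => k /f0 ->.
Qed.

Lemma esum_comp_le f :
  (forall i, 0 <= f i) ->
  (\esum_(i in [set: U]) (f (e i))%:E <= \esum_(k in [set: T]) (f k)%:E)%E.
Proof.
move=> f0; rewrite -(esum_image setT e (EFin \o f)); last first.
  by move=> i j _ _; exact: inje.
by rewrite esum_mkcond; apply: le_esum => k _; case: ifP; rewrite ?lee_fin.
Qed.

Lemma nsummable_comp f :
  (forall i, 0 <= f i) -> nsummable f -> nsummable (fun i => f (e i)).
Proof. by move=> f0; exact/le_lt_trans/esum_comp_le. Qed.

Lemma nsum_comp_le f :
  (forall i, 0 <= f i) -> nsummable f -> nsum (fun i => f (e i)) <= nsum f.
Proof.
by move=> f0 fs; apply: esum_le_nsum => //; rewrite -esum_nsum// esum_comp_le.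
Qed.

End Injections.

Lemma finite_set_bounded (T : choiceType) (h : T -> nat) (A : set T) :
  finite_set A -> exists n, forall k, A k -> (h k < n)%N.
Proof.
move=> /finite_seqP[s ->]; exists (\max_(k <- s) h k).+1 => k /= ks.
by rewrite ltnS leq_bigmax_seq.
Qed.

Lemma nsum_tail_small (f : nat -> R) (eps : R) : (forall i, 0 <= f i) ->
  nsummable f -> 0 < eps ->
  exists n, forall m, (n <= m)%N -> nsum (fun i => f (m + i)%N) <= eps.
Proof.
move=> f0 fs e0; have [A finA Ae] := nsum_cofinite_small f0 fs e0.
have [n An] := finite_set_bounded id finA.
exists n => m nm; set g := fun i => if i \in A then 0 else f i in Ae *.
have g0 i : 0 <= g i by rewrite /g; case: ifP.
have gs : nsummable g by apply: nsummable_le fs => i; rewrite /g; case: ifP.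
apply: le_trans Ae; rewrite [leLHS](_ : _ = nsum (fun i => g (m + i)%N)).
  by apply: nsum_comp_le => //; exact: addnI.
congr nsum; apply/funext => i; rewrite /g ifN//; apply/negP => /[!inE] /An.
by rewrite ltnNge (leq_trans nm)// leq_addr.
Qed.

Lemma sum_geometric_le (A q : R) n : 0 <= A -> 0 <= q -> q < 1 ->
  \sum_(0 <= k < n) A * q ^+ k <= A / (1 - q).
Proof.
move=> A0 q0 q1; have q1' : 0 < 1 - q by rewrite subr_gt0.
have := congr1 (@^~ n) (geometric_seriesE A (negbT (lt_eqF q1))).
rewrite /series/= => ->; rewrite ler_pM2r ?invr_gt0// ler_piMr//.
by rewrite gerBl exprn_ge0.
Qed.

Lemma esum_geometric_le (f : nat -> R) (A q : R) : 0 <= q -> q < 1 ->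
  (forall n, 0 <= f n) -> (forall n, f n <= A * q ^+ n) ->
  (\esum_(n in [set: nat]) (f n)%:E <= (A / (1 - q))%:E)%E.
Proof.
move=> q0 q1 f0 fA; have A0 : 0 <= A.
  by apply: le_trans (f0 0) _; rewrite (le_trans (fA 0))// expr0 mulr1.
rewrite -nneseries_esumT; last by move=> n; rewrite lee_fin.
apply: lime_le; first by apply: is_cvg_nneseries => n _ _; rewrite lee_fin.
apply: nearW => n; rewrite sumEFin lee_fin.
apply: le_trans (ler_sum _ (fun i _ => fA i)) _.
exact: sum_geometric_le.
Qed.

Lemma nsummable_geometric (f : nat -> R) (A q : R) : 0 <= q -> q < 1 ->
  (forall n, 0 <= f n) -> (forall n, f n <= A * q ^+ n) -> nsummable f.
Proof.
by move=> q0 q1 f0 fA; exact: esum_le_nsummable (esum_geometric_le q0 q1 f0 fA).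
Qed.

Lemma nsum_geometric_le (f : nat -> R) (A q : R) : 0 <= q -> q < 1 ->
  (forall n, 0 <= f n) -> (forall n, f n <= A * q ^+ n) ->
  nsum f <= A / (1 - q).
Proof.
by move=> q0 q1 f0 fA; apply: esum_le_nsum => //; exact: esum_geometric_le.
Qed.

End NonnegativeSums.

Section RealSums.
Variable R : realType.

Definition rsummable (T : choiceType) (f : T -> R) :=
  nsummable (fun i => `|f i|).

Definition rsum (T : choiceType) (f : T -> R) : R := nsum f^\+ - nsum f^\-.

Lemma rsummable_funrpos (T : choiceType) (f : T -> R) :
  rsummable f -> nsummable f^\+.
Proof. by apply: nsummable_le => i; rewrite ge_max ler_norm normr_ge0. Qed.

Lemma rsummable_funrneg (T : choiceType) (f : T -> R) :
  rsummable f -> nsummable f^\-.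
Proof.
by apply: nsummable_le => i; rewrite ge_max ler_normr lexx orbT normr_ge0.
Qed.

(* The sum may be computed from any decomposition into nonnegative summable
   parts; all the algebraic laws of [rsum] come from this. *)
Lemma rsum_diff (T : choiceType) (p q : T -> R) : (forall i, 0 <= p i) ->
  (forall i, 0 <= q i) -> nsummable p -> nsummable q ->
  rsum (fun i => p i - q i) = nsum p - nsum q.
Proof.
move=> p0 q0 ps qs; set f := fun i => _.
have fs : rsummable f.
  apply: nsummable_le (nsummableD p0 q0 ps qs) => i.
  by rewrite (le_trans (ler_normB _ _))// !ger0_norm.
have [fp fn] := (rsummable_funrpos fs, rsummable_funrneg fs).
apply/eqP; rewrite /rsum subr_eq addrAC eq_sym subr_eq -!nsumD//; apply/eqP.
congr nsum; apply/funext => i.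
by have := congr1 (@^~ i) (funrposBneg f); rewrite /= {3}/f !fctE; lra.
Qed.

Variable T : choiceType.
Implicit Types f g : T -> R.

Lemma nsum_rsum f : (forall i, 0 <= f i) -> nsummable f -> nsum f = rsum f.
Proof.
move=> f0 fs; rewrite -[LHS]subr0 -(nsum0 R T) -rsum_diff//.
  by congr rsum; apply/funext => i; rewrite subr0.
by rewrite /nsummable esum1// ltry.
Qed.

Lemma rsummableN f : rsummable f -> rsummable (fun i => - f i).
Proof. by apply: nsummable_le => i; rewrite normrN. Qed.

Lemma rsummableZ (c : R) f : rsummable f -> rsummable (fun i => c * f i).
Proof.
move=> fs; apply: nsummable_le (nsummableZ (normr_ge0 c) _ fs) => // i.
by rewrite normrM.
Qed.

Lemma rsumD f g : rsummable f -> rsummable g ->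
  rsum (fun i => f i + g i) = rsum f + rsum g.
Proof.
move=> fs gs; have [fp fn] := (rsummable_funrpos fs, rsummable_funrneg fs).
have [gp gn] := (rsummable_funrpos gs, rsummable_funrneg gs).
have -> : (fun i => f i + g i) =
    (fun i => (f^\+ i + g^\+ i) - (f^\- i + g^\- i)).
  apply/funext => i; rewrite opprD addrACA.
  by rewrite -{1}(funrposBneg f) -{1}(funrposBneg g).
rewrite rsum_diff; first by rewrite !nsumD// opprD addrACA.
- by move=> i; rewrite addr_ge0.
- by move=> i; rewrite addr_ge0.
- exact: nsummableD.
- exact: nsummableD.
Qed.

Lemma rsumN f : rsum (fun i => - f i) = - rsum f.
Proof. by rewrite /rsum opprB -funrposN -(funrnegN f). Qed.

Lemma rsumZ (c : R) f : rsummable f -> rsum (fun i => c * f i) = c * rsum f.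
Proof.
move=> fs; have [fp fn] := (rsummable_funrpos fs, rsummable_funrneg fs).
have ge0_rsumZ (d : R) : 0 <= d -> rsum (fun i => d * f i) = d * rsum f.
  move=> d0; rewrite /rsum (ge0_funrposM f d0) (ge0_funrnegM f d0).
  by rewrite !nsumZ// mulrBr.
have [c0|/ltW c0] := leP 0 c; first exact: ge0_rsumZ.
rewrite -[RHS]opprK -mulNr -ge0_rsumZ ?oppr_ge0// -rsumN; congr rsum.
by apply/funext => i; rewrite mulNr opprK.
Qed.

Lemma le_rsum f g : rsummable f -> rsummable g -> (forall i, f i <= g i) ->
  rsum f <= rsum g.
Proof.
move=> fs gs fg; have fg0 i : 0 <= g i - f i by rewrite subr_ge0.
have gfs : nsummable (fun i => g i - f i).
  apply: nsummable_le (nsummableD _ _ gs fs) => // i.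
  by rewrite (le_trans (ler_norm _))// ler_normB.
by rewrite -subr_ge0 -rsumN -rsumD ?rsummableN// -nsum_rsum// nsum_ge0.
Qed.

Lemma rsum_unit (h : unit -> R) : rsum h = h tt.
Proof. by rewrite -{2}(funrposBneg h) /rsum !nsum_unit. Qed.

Lemma reindex_rsum_inj (U : choiceType) (e : U -> T) f : injective e ->
  (forall k, ~ range e k -> f k = 0) -> rsum f = rsum (fun i => f (e i)).
Proof.
move=> inje f0; congr (_ - _); apply: reindex_nsum_inj => // k /f0 fk.
  by rewrite /funrpos fk maxxx.
by rewrite /funrneg fk oppr0 maxxx.
Qed.

End RealSums.

Section IteratedSums.
Variables (R : realType) (T U : choiceType).

Lemma esum_pair (F : T * U -> R) : (forall k, 0 <= F k) ->
  (\esum_(k in [set: T * U]) (F k)%:E =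
   \esum_(i in [set: T]) \esum_(j in [set: U]) (F (i, j))%:E)%E.
Proof.
move=> F0; rewrite esum_esum; last by move=> *; rewrite lee_fin.
rewrite (_ : [set: T] `*`` _ = setT); last by apply/seteqP; split.
by apply: eq_esum => -[].
Qed.

Lemma nsummable_row (F : T * U -> R) i : (forall k, 0 <= F k) -> nsummable F ->
  nsummable (fun j => F (i, j)).
Proof. by apply: nsummable_comp => j j' []. Qed.

Lemma esum_rows (F : T * U -> R) : (forall k, 0 <= F k) ->
  (forall i, nsummable (fun j => F (i, j))) ->
  (\esum_(k in [set: T * U]) (F k)%:E =
   \esum_(i in [set: T]) (nsum (fun j => F (i, j)))%:E)%E.
Proof.
by move=> F0 Fs; rewrite esum_pair//; under eq_esum do rewrite esum_nsum//.
Qed.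

Lemma nsummable_pair (F : T * U -> R) : (forall k, 0 <= F k) ->
  (forall i, nsummable (fun j => F (i, j))) ->
  nsummable (fun i => nsum (fun j => F (i, j))) -> nsummable F.
Proof. by move=> F0 Fs; rewrite /nsummable esum_rows. Qed.

Lemma nsummable_rows (F : T * U -> R) : (forall k, 0 <= F k) -> nsummable F ->
  nsummable (fun i => nsum (fun j => F (i, j))).
Proof.
by move=> F0 Fs; rewrite /nsummable -esum_rows// => i; exact: nsummable_row.
Qed.

Lemma nsum_rows (F : T * U -> R) : (forall k, 0 <= F k) -> nsummable F ->
  nsum F = nsum (fun i => nsum (fun j => F (i, j))).
Proof.
by move=> F0 Fs; rewrite /nsum esum_rows// => i; exact: nsummable_row.
Qed.

Lemma rsum_rows (F : T * U -> R) : rsummable F ->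
  rsum F = rsum (fun i => rsum (fun j => F (i, j))).
Proof.
move=> Fs; have [Fp Fn] := (rsummable_funrpos Fs, rsummable_funrneg Fs).
rewrite [LHS]/rsum !nsum_rows// -rsum_diff//.
- by move=> i; exact: nsum_ge0.
- by move=> i; exact: nsum_ge0.
- exact: nsummable_rows Fp.
- exact: nsummable_rows Fn.
Qed.

End IteratedSums.

Section ComplexSums.
Variable R : realType.

Definition csummable (T : choiceType) (f : T -> R[i]) :=
  nsummable (fun i => cmod (f i)).

Definition csum (T : choiceType) (f : T -> R[i]) : R[i] :=
  rsum (fun i => complex.Re (f i)) +i* rsum (fun i => complex.Im (f i)).

Lemma csummable_Re (T : choiceType) (f : T -> R[i]) :
  csummable f -> rsummable (fun i => complex.Re (f i)).
Proof. by apply: nsummable_le => i; exact: normr_Re_le_cmod. Qed.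

Lemma csummable_Im (T : choiceType) (f : T -> R[i]) :
  csummable f -> rsummable (fun i => complex.Im (f i)).
Proof. by apply: nsummable_le => i; exact: normr_Im_le_cmod. Qed.

Section Theory.
Variable T : choiceType.
Implicit Types f g : T -> R[i].

Lemma csummable_le f (g : T -> R) : (forall i, cmod (f i) <= g i) ->
  nsummable g -> csummable f.
Proof. exact: nsummable_le. Qed.

Lemma csummable0 : csummable (fun _ : T => 0 : R[i]).
Proof.
by rewrite /csummable /nsummable esum1 ?ltry// => i _; rewrite cmod0.
Qed.

Lemma csummableD f g : csummable f -> csummable g ->
  csummable (fun i => f i + g i).
Proof.
move=> fs gs; apply: csummable_le (nsummableD _ _ fs gs) => i;
  by rewrite ?cmod_ge0 ?cmodD.
Qed.

Lemma csummableZ (c : R[i]) f : csummable f -> csummable (fun i => c * f i).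
Proof.
by move=> fs; apply: csummable_le (nsummableZ (cmod_ge0 c) _ fs) => i;
  rewrite ?cmod_ge0 ?cmodM.
Qed.

Lemma csummableN f : csummable f -> csummable (fun i => - f i).
Proof. by apply: csummable_le => i; rewrite cmodN. Qed.

Lemma csummable_if (P : pred T) f : csummable f ->
  csummable (fun i => if P i then f i else 0).
Proof. by apply: csummable_le => i; case: ifP; rewrite ?cmod0 ?cmod_ge0. Qed.

Lemma csumD f g : csummable f -> csummable g ->
  csum (fun i => f i + g i) = csum f + csum g.
Proof.
move=> fs gs; have [fr fi] := (csummable_Re fs, csummable_Im fs).
have [gr gi] := (csummable_Re gs, csummable_Im gs).
by congr (_ +i* _); rewrite -rsumD//; congr rsum; apply/funext => i;
  case: (f i) (g i) => [a b] [c d].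
Qed.

Lemma csumZ (c : R[i]) f : csummable f -> csum (fun i => c * f i) = c * csum f.
Proof.
move=> fs; have [fr fi] := (csummable_Re fs, csummable_Im fs).
case: c => a b; congr (_ +i* _); rewrite -?mulNr -!rsumZ// -rsumD;
  try (exact: rsummableZ); congr rsum; apply/funext => i;
  by case: (f i) => c d; rewrite /= ?mulNr.
Qed.

Lemma csumN f : csum (fun i => - f i) = - csum f.
Proof.
by congr (_ +i* _); rewrite -rsumN; congr rsum; apply/funext => i; case: (f i).
Qed.

Lemma csumB f g : csummable f -> csummable g ->
  csum (fun i => f i - g i) = csum f - csum g.
Proof. by move=> fs gs; rewrite csumD ?csumN//; exact: csummableN. Qed.

Lemma csum0 : csum (fun _ : T => 0 : R[i]) = 0.
Proof. by have := csumZ 0 csummable0; rewrite !mul0r. Qed.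

Lemma csummable_sum (I : Type) (s : seq I) (F : I -> T -> R[i]) :
  (forall i, csummable (F i)) -> csummable (fun k => \sum_(i <- s) F i k).
Proof.
move=> Fs; elim: s => [|i s ih].
  by under eq_fun do rewrite big_nil; exact: csummable0.
by under eq_fun do rewrite big_cons; exact: csummableD.
Qed.

Lemma csum_sum (I : Type) (s : seq I) (F : I -> T -> R[i]) :
  (forall i, csummable (F i)) ->
  csum (fun k => \sum_(i <- s) F i k) = \sum_(i <- s) csum (F i).
Proof.
move=> Fs; elim: s => [|i s ih].
  by under eq_fun do rewrite big_nil; rewrite csum0 big_nil.
under eq_fun do rewrite big_cons.
by rewrite csumD// ?ih ?big_cons//; exact: csummable_sum.
Qed.

Lemma cmod_csum f : csummable f -> cmod (csum f) <= nsum (fun i => cmod (f i)).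
Proof.
move=> fs; have n0 i : 0 <= cmod (f i) by exact: cmod_ge0.
have [s0|s0] := eqVneq (csum f) 0; first by rewrite s0 cmod0 nsum_ge0.
pose u := `|csum f| / csum f.
have u1 : cmod u = 1.
  rewrite cmodM cmodV normC_cmod cmod_real ger0_norm ?cmod_ge0//.
  by rewrite divff ?cmod_eq0.
have -> : cmod (csum f) = rsum (fun i => complex.Re (u * f i)).
  by rewrite -[RHS]/(complex.Re (csum (fun i => u * f i))) csumZ// divfK.
rewrite nsum_rsum//; apply: le_rsum.
- exact/csummable_Re/csummableZ.
- by apply: nsummable_le fs => i; rewrite ger0_norm.
- move=> i; rewrite (le_trans (ler_norm _))// (le_trans (normr_Re_le_cmod _))//.
  by rewrite cmodM u1 mul1r.
Qed.

End Theory.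

Section Injections.
Variables (T U : choiceType) (e : U -> T).
Hypothesis inje : injective e.
Implicit Types f : T -> R[i].

Lemma csummable_comp f : csummable f -> csummable (fun i => f (e i)).
Proof.
apply: (nsummable_comp inje (f := fun i => cmod (f i))) => i.
exact: cmod_ge0.
Qed.

Lemma csummable_reindex_inj f : (forall k, ~ range e k -> f k = 0) ->
  csummable (fun i => f (e i)) -> csummable f.
Proof.
by move=> f0; apply: (nsummable_reindex_inj inje) => k /f0 ->; rewrite cmod0.
Qed.

Lemma reindex_csum_inj f : (forall k, ~ range e k -> f k = 0) ->
  csum f = csum (fun i => f (e i)).
Proof.
by move=> f0; congr (_ +i* _); apply: reindex_rsum_inj => // k /f0 ->.
Qed.

End Injections.

Lemma csum_unit (f : unit -> R[i]) : csum f = f tt.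
Proof. by rewrite /csum !rsum_unit; case: (f tt). Qed.

Section Delta.
Variables (T : choiceType) (k0 : T) (z : R[i]).

Let delta k := if k == k0 then z else 0.

Let injective_k0 : injective (fun _ : unit => k0).
Proof. by move=> [] []. Qed.

Let delta_off k : ~ range (fun _ : unit => k0) k -> delta k = 0.
Proof. by rewrite /delta; case: eqP => [->|//] []; exists tt. Qed.

Lemma csummable_delta : csummable delta.
Proof.
apply: (csummable_reindex_inj injective_k0 delta_off).
by rewrite /csummable /nsummable esum_unit ?ltry// lee_fin cmod_ge0.
Qed.

Lemma nsum_delta : nsum (fun k => cmod (delta k)) = cmod z.
Proof.
rewrite (reindex_nsum_inj injective_k0) => [|k /delta_off ->]; last first.
  exact: cmod0.
by rewrite nsum_unit /delta ?eqxx// => i; exact: cmod_ge0.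
Qed.

Lemma csum_delta : csum delta = z.
Proof.
by rewrite (reindex_csum_inj injective_k0 delta_off) csum_unit /delta eqxx.
Qed.

End Delta.

End ComplexSums.

Section IteratedComplexSums.
Variable R : realType.

Definition csummable2 (T U : choiceType) (F : T -> U -> R[i]) :=
  csummable (fun p : T * U => F p.1 p.2).

Variables T U : choiceType.
Implicit Types F : T -> U -> R[i].

Lemma csummable2C F : csummable2 F -> csummable2 (fun j i => F i j).
Proof.
move=> Fs; apply: (csummable_comp (e := fun p : U * T => (p.2, p.1)) _ Fs).
by move=> [a b] [c d] [-> ->].
Qed.

Lemma csummable2_row F i : csummable2 F -> csummable (F i).
Proof. by move=> Fs; apply: (csummable_comp (e := pair i) _ Fs) => j j' []. Qed.

Lemma csummable2_of_rows F : (forall i, csummable (F i)) ->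
  nsummable (fun i => nsum (fun j => cmod (F i j))) -> csummable2 F.
Proof. by apply: nsummable_pair => p; exact: cmod_ge0. Qed.

Lemma nsummable_rows_cmod F : csummable2 F ->
  nsummable (fun i => nsum (fun j => cmod (F i j))).
Proof.
apply: (nsummable_rows (F := fun p => cmod (F p.1 p.2))) => p.
exact: cmod_ge0.
Qed.

Lemma csummable_csum F : csummable2 F -> csummable (fun i => csum (F i)).
Proof.
move=> Fs; apply: csummable_le (nsummable_rows_cmod Fs) => i.
exact/cmod_csum/csummable2_row.
Qed.

Lemma csum_rows F : csummable2 F ->
  csum (fun p => F p.1 p.2) = csum (fun i => csum (F i)).
Proof.
move=> Fs; rewrite {1}/csum (rsum_rows (csummable_Re Fs)).
by rewrite (rsum_rows (csummable_Im Fs)).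
Qed.

End IteratedComplexSums.

Section Exchange.
Variables (R : realType) (T U : choiceType) (F : T -> U -> R[i]).
Hypothesis Fs : csummable2 F.

Let swap (p : U * T) := (p.2, p.1).

Let swap_inj : injective swap.
Proof. by move=> [a b] [c d] [-> ->]. Qed.

Let swap_onto p : range swap p.
Proof. by case: p => a b; exists (b, a). Qed.

Lemma exchange_csum :
  csum (fun i => csum (F i)) = csum (fun j => csum (fun i => F i j)).
Proof.
rewrite -csum_rows// (reindex_csum_inj swap_inj) => [|k /(_ (swap_onto k))//].
by rewrite (csum_rows (csummable2C Fs)).
Qed.

Lemma nsum_cmod_csum_le : nsum (fun j => cmod (csum (fun i => F i j))) <=
  nsum (fun i => nsum (fun j => cmod (F i j))).
Proof.
have Fs' := csummable2C Fs.
have F_ge0 (p : T * U) : 0 <= cmod (F p.1 p.2) by exact: cmod_ge0.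
rewrite -(nsum_rows F_ge0 Fs) (reindex_nsum_inj swap_inj); last first.
  by move=> k /(_ (swap_onto k)).
rewrite [leRHS](nsum_rows _ Fs') => [|p]; last exact: cmod_ge0.
apply: le_nsum => [j|j|]; [exact: cmod_ge0| |exact: nsummable_rows_cmod].
exact/cmod_csum/(csummable2_row j Fs').
Qed.

End Exchange.

Section ComplexTopology.
Variable R : realType.

Lemma gtr0_real_complex (e : R[i]) : 0 < e -> exists2 d : R, 0 < d & e = d%:C.
Proof.
move=> e0; exists (complex.Re e); last by rewrite RRe_real// gtr0_real.
by move: e0; rewrite ltcE => /andP[].
Qed.

Lemma cvg_cmodP (T : Type) (F : set_system T) (FF : Filter F) (u : T -> R[i])
    (l : R[i]) :
  (u : T -> R[i]^o) @ F --> (l : R[i]^o) <->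
  forall e : R, 0 < e -> \forall x \near F, cmod (l - u x) < e.
Proof.
split=> [/cvgrPdist_lt ul e e0|ul].
  have /ul : 0 < e%:C by rewrite ltcR.
  by apply: filterS => x; rewrite normC_cmod ltcR.
apply/cvgrPdist_lt => _ /gtr0_real_complex[e e0 ->].
by apply: filterS (ul _ e0) => x; rewrite normC_cmod ltcR.
Qed.

Lemma near_cmodP (z : R[i]^o) (P : set R[i]^o) :
  (\forall t \near z, P t) <->
  exists2 d : R, 0 < d & forall t : R[i], cmod (z - t) < d -> P t.
Proof.
split=> [/nbhs_ballP[_ /gtr0_real_complex[d d0 ->] h]|[d d0 h]].
  by exists d => // t zt; apply: h; rewrite -ball_normE /= normC_cmod ltcR.
apply/nbhs_ballP; exists d%:C => /=; first by rewrite ltcR.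
by move=> t; rewrite -ball_normE /= normC_cmod ltcR; exact: h.
Qed.

End ComplexTopology.

Section SequenceSums.
Variable R : realType.
Implicit Types f : nat -> R[i].

Lemma csum_recl f : csummable f -> csum f = f 0%N + csum (fun n => f n.+1).
Proof.
move=> fs; rewrite -(csum_delta 0%N (f 0%N)).
pose f_pos k := if k == 0%N then 0 else f k.
rewrite -(reindex_csum_inj succn_inj (f := f_pos)).
  rewrite -csumD; [|exact: csummable_delta|].
    by congr csum; apply/funext => -[|k] /=; rewrite ?addr0 ?add0r.
  by apply: csummable_le fs => -[|k] /=; rewrite ?cmod0 ?cmod_ge0.
by move=> [|k] // /(_ (ex_intro2 _ _ k I erefl)).
Qed.

Lemma csummable_tail n f : csummable f -> csummable (fun k => f (n + k)%N).
Proof. by apply: csummable_comp; exact: addnI. Qed.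

Lemma csum_tail n f : csummable f ->
  csum f = \sum_(k < n) f k + csum (fun k => f (n + k)%N).
Proof.
move=> fs; elim: n => [|n ih].
  by rewrite big_ord0 add0r; congr csum; apply/funext => k; rewrite add0n.
rewrite ih big_ord_recr/= csum_recl; last exact: csummable_tail.
rewrite addn0 -addrA; congr (_ + (_ + csum _)).
by apply/funext => k; rewrite addnS.
Qed.

Lemma csum_cvg f : csummable f ->
  (series (f : nat -> R[i]^o)) @ \oo --> (csum f : R[i]^o).
Proof.
move=> fs; apply/cvg_cmodP => e e0.
have e2 : 0 < e / 2 by rewrite divr_gt0.
have [n ne] := nsum_tail_small (fun k => cmod_ge0 (f k)) fs e2.
exists n => // m nm; rewrite /series/= big_mkord (csum_tail m fs) addrC addKr.
apply: le_lt_trans (cmod_csum (csummable_tail m fs)) _.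
by rewrite (le_lt_trans (ne _ nm))//; lra.
Qed.

Lemma lim_series_csum f : csummable f ->
  limn (series (f : nat -> R[i]^o)) = csum f.
Proof. by move=> fs; apply: cvg_lim => //; exact: csum_cvg. Qed.

End SequenceSums.

Section IntegerSums.
Variable R : realType.

Definition negS (n : nat) : int := - n.+1%:Z.

Lemma Posz_inj : injective Posz. Proof. by move=> m n []. Qed.

Lemma negS_inj : injective negS. Proof. by move=> m n []. Qed.

Lemma csum_int (f : int -> R[i]) : csummable f ->
  csum f = csum (fun n => f (Posz n)) + csum (fun n => f (negS n)).
Proof.
move=> fs.
transitivity (csum (fun k : int => if 0 <= k then f k else 0) +
              csum (fun k : int => if k < 0 then f k else 0)).
  rewrite -csumD; try exact: csummable_if.
  by congr csum; apply/funext => k; case: ltP; rewrite ?addr0 ?add0r.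
congr (_ + _).
  by rewrite (reindex_csum_inj Posz_inj)// => -[] k // []; exists k.
by rewrite (reindex_csum_inj negS_inj)// => -[] k // []; exists k.
Qed.

Lemma csum_shift (m : int) (f : int -> R[i]) :
  csum (fun k => f (k - m)) = csum f.
Proof.
rewrite [RHS](reindex_csum_inj (@addIr _ (- m)))// => k [].
by exists (k + m); rewrite ?addrK.
Qed.

Lemma nsum_shift (m : int) (f : int -> R) : nsum (fun k => f (k - m)) = nsum f.
Proof.
rewrite [RHS](reindex_nsum_inj (@addIr _ (- m)))// => k [].
by exists (k + m); rewrite ?addrK.
Qed.

Lemma csummable_shift (m : int) (f : int -> R[i]) : csummable f ->
  csummable (fun k => f (k - m)).
Proof. by apply: csummable_comp; exact: addIr. Qed.

End IntegerSums.

(** * The scalar Wiener algebra *)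

Section RootsOfUnity.

Lemma closed_field_prim_root (F : closedFieldType) n : n%:R != 0 :> F ->
  exists w : F, n.-primitive_root w.
Proof.
move=> nF; have n0 : (0 < n)%N by case: n nF => //; rewrite eqxx.
have pm : 'X^n - 1 \is @monic F by rewrite monicXnsubC.
have [r] := closed_field_poly_normal ('X^n - 1 : {poly F}).
rewrite (monicP pm) scale1r => dp.
have rn1 : all n.-unity_root r by apply/allP => z; rewrite -root_prod_XsubC -dp.
have szr : (n < (size r).+1)%N.
  by rewrite -(size_prod_XsubC r id) -dp size_XnsubC.
have [|w] := hasP (has_prim_root n0 rn1 _ szr); last by exists w.
by rewrite -separable_prod_XsubC -dp separable_Xn_sub_1.
Qed.

Lemma sum_prim_root_expz (F : fieldType) n (w : F) (k : int) :
  n.-primitive_root w -> ~~ (n %| `|k|)%N -> \sum_(j < n) (w ^+ j) ^ k = 0.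
Proof.
move=> wn nk; have wk : w ^ k - 1 != 0.
  rewrite subr_eq0; apply: contra nk.
  by case: k => m; rewrite ?NegzE /exprz ?invr_eq1 -(prim_order_dvd wn).
under eq_bigr do rewrite exprnP exprzAC.
apply: (mulfI wk); rewrite mulr0.
by rewrite -subrX1 exprnP exprzAC -exprnP (prim_expr_order wn) exp1rz subrr.
Qed.

End RootsOfUnity.

Section Circle.
Variable R : realType.

Record circle := Circle {
  circle_val :> R[i];
  cmod_circle : cmod circle_val = 1 }.

Lemma circle_neq0 (z : circle) : z != 0 :> R[i].
Proof. by rewrite -cmod_eq0 cmod_circle oner_eq0. Qed.

Lemma cmod_circleXz (z : circle) (k : int) : cmod ((z : R[i]) ^ k) = 1.
Proof. by rewrite cmodXz cmod_circle exp1rz. Qed.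

Lemma cmod_prim_root n (w : R[i]) : n.-primitive_root w -> cmod w = 1.
Proof.
move=> wn; have n0 := prim_order_gt0 wn; apply/eqP.
by rewrite -(pexpr_eq1 n0 (cmod_ge0 w)) -cmodX (prim_expr_order wn) cmod1.
Qed.

End Circle.

Section LaurentSeries.
Variable R : realType.

Record laurent := Laurent {
  lcoef :> int -> R[i];
  lcoef_summable : csummable lcoef }.

HB.instance Definition _ := gen_eqMixin laurent.
HB.instance Definition _ := gen_choiceMixin laurent.

Implicit Types (x y : laurent) (z : circle R).

Lemma laurentP x y : lcoef x =1 lcoef y -> x = y.
Proof.
case: x y => [c cs] [d ds] /= /funext cd.
by rewrite cd in cs *; congr Laurent; exact: bool_irrelevance.
Qed.

Definition lmono (k : int) (a : R[i]) := Laurent (csummable_delta k a).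
Definition ladd x y :=
  Laurent (csummableD (lcoef_summable x) (lcoef_summable y)).
Definition lopp x := Laurent (csummableN (lcoef_summable x)).

Fact laddA : associative ladd.
Proof. by move=> x y z; apply: laurentP => k /=; rewrite addrA. Qed.
Fact laddC : commutative ladd.
Proof. by move=> x y; apply: laurentP => k /=; rewrite addrC. Qed.
Fact ladd0 : left_id (lmono 0 0) ladd.
Proof. by move=> x; apply: laurentP => k /=; rewrite if_same add0r. Qed.
Fact laddN : left_inverse (lmono 0 0) lopp ladd.
Proof. by move=> x; apply: laurentP => k /=; rewrite if_same addNr. Qed.

HB.instance Definition _ := GRing.isZmodule.Build laurent
  laddA laddC ladd0 laddN.

Lemma lcoefD x y k : (x + y) k = x k + y k. Proof. by []. Qed.
Lemma lcoefN x k : (- x) k = - x k. Proof. by []. Qed.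
Lemma lcoefB x y k : (x - y) k = x k - y k. Proof. by []. Qed.
Lemma lcoef0 k : (0 : laurent) k = 0. Proof. by rewrite /= if_same. Qed.

Definition lnorm x : R := nsum (fun k => cmod (x k)).

Lemma lnorm_ge0 x : 0 <= lnorm x.
Proof. by apply: nsum_ge0 => k; exact: cmod_ge0. Qed.

Lemma lnorm_mono k (a : R[i]) : lnorm (lmono k a) = cmod a.
Proof. exact: nsum_delta. Qed.

Lemma lnorm0 : lnorm 0 = 0.
Proof. by rewrite lnorm_mono cmod0. Qed.

Lemma lnormN x : lnorm (- x) = lnorm x.
Proof. by congr nsum; apply/funext => k; rewrite cmodN. Qed.

Lemma lnormD x y : lnorm (x + y) <= lnorm x + lnorm y.
Proof.
have [xs ys] := (lcoef_summable x, lcoef_summable y).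
rewrite /lnorm -nsumD//; try by move=> k; exact: cmod_ge0.
apply: le_nsum => [k|k|]; [exact: cmod_ge0|exact: cmodD|].
by apply: nsummableD => // k; exact: cmod_ge0.
Qed.

Lemma lnorm_sum (I : Type) (s : seq I) (P : pred I) (F : I -> laurent) :
  lnorm (\sum_(i <- s | P i) F i) <= \sum_(i <- s | P i) lnorm (F i).
Proof.
elim/big_rec2: _ => [|i u v _ uv]; first by rewrite lnorm0.
by rewrite (le_trans (lnormD _ _))// lerD2l.
Qed.

Lemma cmod_coef_le x k : cmod (x k) <= lnorm x.
Proof.
rewrite -(nsum_delta k (x k)).
apply: le_nsum => [j|j|]; [exact: cmod_ge0| |exact: lcoef_summable].
by case: eqP => [->|_]; rewrite ?cmod0 ?cmod_ge0.
Qed.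

Lemma lnorm_le0_eq0 x : lnorm x <= 0 -> x = 0.
Proof.
move=> x0; apply: laurentP => k; rewrite lcoef0; apply/eqP.
by rewrite -cmod_eq0 eq_le cmod_ge0 (le_trans (cmod_coef_le _ _)).
Qed.

Definition lev z x : R[i] := csum (fun k => x k * (z : R[i]) ^ k).

Lemma cmod_lev_term z x k : cmod (x k * (z : R[i]) ^ k) = cmod (x k).
Proof. by rewrite cmodM cmod_circleXz mulr1. Qed.

Lemma csummable_lev z x : csummable (fun k => x k * (z : R[i]) ^ k).
Proof.
by apply: csummable_le (lcoef_summable x) => k; rewrite cmod_lev_term.
Qed.

Lemma cmod_lev_le z x : cmod (lev z x) <= lnorm x.
Proof.
apply: le_trans (cmod_csum (csummable_lev z x)) _.
by under eq_fun do rewrite cmod_lev_term.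
Qed.

Lemma lev_mono z k (a : R[i]) : lev z (lmono k a) = a * (z : R[i]) ^ k.
Proof.
rewrite /lev -[RHS](csum_delta k); congr csum; apply/funext => j /=.
by case: eqP => [->|]; rewrite ?mul0r.
Qed.

Fact lev_is_zmod_morphism z : zmod_morphism (lev z).
Proof.
move=> x y; rewrite /lev -csumB; try exact: csummable_lev.
by congr csum; apply/funext => k; rewrite mulrBl.
Qed.

HB.instance Definition _ z :=
  GRing.isZmodMorphism.Build laurent R[i] (lev z) (lev_is_zmod_morphism z).

End LaurentSeries.

Section LaurentSums.
Variables (R : realType) (T : choiceType).
Implicit Types u v : T -> laurent R.

Definition lsummable u := nsummable (fun i => lnorm (u i)).

Lemma csummable2_lcoef u : lsummable u -> csummable2 (fun i k => u i k).
Proof.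
by move=> us; apply: csummable2_of_rows us => i; exact: lcoef_summable.
Qed.

(* The zero series when [u] is not absolutely summable. *)
Definition lsum u : laurent R :=
  if pselect (lsummable u) is left us
  then Laurent (csummable_csum (csummable2C (csummable2_lcoef us))) else 0.

Lemma lcoef_lsum u k : lsummable u -> lsum u k = csum (fun i => u i k).
Proof. by rewrite /lsum; case: pselect. Qed.

Lemma lnorm_lsum_le u : lsummable u ->
  lnorm (lsum u) <= nsum (fun i => lnorm (u i)).
Proof.
move=> us; apply: le_trans (nsum_cmod_csum_le (csummable2_lcoef us)).
by rewrite /lnorm; under eq_fun do rewrite lcoef_lsum//.
Qed.

Lemma lev_lsum z u : lsummable u ->
  lev z (lsum u) = csum (fun i => lev z (u i)).
Proof.
move=> us; have us2 := csummable2_lcoef us.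
rewrite /lev [RHS]exchange_csum; last first.
  by apply: csummable_le us2 => p; rewrite cmod_lev_term.
congr csum; apply/funext => k; rewrite lcoef_lsum// mulrC -csumZ; last first.
  exact: csummable2_row (csummable2C us2).
by congr csum; apply/funext => i; rewrite mulrC.
Qed.

End LaurentSums.

Section LaurentEvaluation.
Variable R : realType.
Implicit Types (x y : laurent R) (z : circle R).

Fact csummable_laurent_shift k (a : R[i]) x :
  csummable (fun n => a * x (n - k)).
Proof. exact: csummableZ (csummable_shift k (lcoef_summable x)). Qed.

Definition laurent_shift k (a : R[i]) x :=
  Laurent (csummable_laurent_shift k a x).

Lemma lnorm_laurent_shift k (a : R[i]) x :
  lnorm (laurent_shift k a x) = cmod a * lnorm x.
Proof.
rewrite /lnorm -nsumZ ?cmod_ge0//; last 2 first.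
- by move=> n; exact: cmod_ge0.
- exact: lcoef_summable.
rewrite -[RHS](nsum_shift k); congr nsum.
by apply/funext => n; rewrite cmodM.
Qed.

Lemma lev_laurent_shift z k (a : R[i]) x :
  lev z (laurent_shift k a x) = a * (z : R[i]) ^ k * lev z x.
Proof.
rewrite /lev -csumZ; last exact: csummable_lev.
rewrite -[RHS](csum_shift k); congr csum; apply/funext => n /=.
by rewrite mulrACA -expfzDr ?circle_neq0// addrCA subrr addr0.
Qed.

Section RootMeans.
Variables (n : nat) (w : R[i]).
Hypothesis wn : n.-primitive_root w.

Definition mean_expz (k : int) : R[i] := n%:R^-1 * \sum_(j < n) (w ^+ j) ^ k.

Let n0 : (0 < n)%N. Proof. exact: prim_order_gt0 wn. Qed.

Let cmod_wX (j : nat) : cmod (w ^+ j) = 1.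
Proof. by rewrite cmodX (cmod_prim_root wn) expr1n. Qed.

Lemma mean_expz0 : mean_expz 0 = 1.
Proof.
rewrite /mean_expz; under eq_bigr do rewrite expr0z.
by rewrite sumr_const card_ord mulVf// pnatr_eq0 -lt0n.
Qed.

Lemma mean_expz_eq0 k : k != 0 -> (`|k| < n)%N -> mean_expz k = 0.
Proof.
move=> k0 kn; rewrite /mean_expz (sum_prim_root_expz wn) ?mulr0// gtnNdvd//.
by rewrite absz_gt0.
Qed.

Lemma cmod_mean_le (f : nat -> R[i]) (M : R) : (forall j, cmod (f j) <= M) ->
  cmod (n%:R^-1 * \sum_(j < n) f j) <= M.
Proof.
move=> fM; rewrite cmodM cmodV cmod_natr ler_pdivrMl ?ltr0n//.
apply: le_trans (cmod_sum _ _ _) (le_trans (ler_sum _ (fun j _ => fM _)) _).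
by rewrite sumr_const card_ord mulr_natl.
Qed.

Lemma cmod_mean_expz_le1 k : cmod (mean_expz k) <= 1.
Proof.
apply: (cmod_mean_le (f := fun j => (w ^+ j) ^ k)) => j.
by rewrite cmodXz cmod_wX exp1rz.
Qed.

Lemma csummable_mean_expz x : csummable (fun k => x k * mean_expz k).
Proof.
apply: csummable_le (lcoef_summable x) => k.
by rewrite cmodM ler_piMr ?cmod_ge0// cmod_mean_expz_le1.
Qed.

Lemma csum_mean_expz x : csum (fun k => x k * mean_expz k) =
  n%:R^-1 * \sum_(j < n) lev (Circle (cmod_wX j)) x.
Proof.
have xs (j : 'I_n) := csummable_lev (Circle (cmod_wX j)) x.
rewrite -[X in _ * X]big_enum/= -csum_sum// -csumZ; last exact: csummable_sum.
congr csum; apply/funext => k; rewrite /mean_expz mulrCA big_enum/=.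
by congr (_ * _); rewrite mulr_sumr.
Qed.

Lemma cmod_csum_mean_expz_le x (M : R) : (forall z, cmod (lev z x) <= M) ->
  cmod (csum (fun k => x k * mean_expz k)) <= M.
Proof.
move=> xM; rewrite csum_mean_expz.
exact: (cmod_mean_le (f := fun j => lev (Circle (cmod_wX j)) x)).
Qed.

Lemma cmod_coef0_sub_mean_le x (A : set int) :
  (forall k, A k -> (`|k| < n)%N) ->
  cmod (x 0 - csum (fun k => x k * mean_expz k)) <=
  nsum (fun k => if k \in A then 0 else cmod (x k)).
Proof.
move=> An; rewrite -(csum_delta (0 : int) (x 0)) -csumB; last 2 first.
- exact: csummable_delta.
- exact: csummable_mean_expz.
have x0 k : 0 <= cmod (x k) by exact: cmod_ge0.
have xA k : cmod ((if k == 0 then x 0 else 0) - x k * mean_expz k) <=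
    (if k \in A then 0 else cmod (x k)).
  have [->|k0] := eqVneq k 0.
    by rewrite mean_expz0 mulr1 subrr cmod0; case: ifP.
  rewrite sub0r cmodN; case: ifPn => [/[!inE] Ak|_].
    by rewrite mean_expz_eq0 ?An// mulr0 cmod0.
  by rewrite cmodM ler_piMr// cmod_mean_expz_le1.
have As : nsummable (fun k => if k \in A then 0 else cmod (x k)).
  by apply: nsummable_le (lcoef_summable x) => k; case: ifP.
apply: le_trans (cmod_csum (csummable_le xA As)) (le_nsum _ xA As) => k.
exact: cmod_ge0.
Qed.

End RootMeans.

(* Averaging over the n-th roots of unity keeps the coefficient of index 0 and
   removes the other ones of index smaller than n. *)
Lemma cmod_coef0_le x (M : R) : (forall z, cmod (lev z x) <= M) ->
  cmod (x 0) <= M.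
Proof.
move=> xM; apply/ler_addgt0Pr => e e0.
have [A finA Ae] :=
  nsum_cofinite_small (fun k => cmod_ge0 (x k)) (lcoef_summable x) e0.
have [n An] := finite_set_bounded absz finA.
have [w wn] : exists w : R[i], n.+1.-primitive_root w.
  by apply: closed_field_prim_root; rewrite pnatr_eq0.
pose c := csum (fun k => x k * mean_expz n.+1 w k).
have -> : x 0 = c + (x 0 - c) by rewrite addrC subrK.
apply: (le_trans (cmodD _ _)); apply: lerD.
  exact: (cmod_csum_mean_expz_le wn).
apply: le_trans Ae; apply: cmod_coef0_sub_mean_le => // k /An.
exact: ltnW.
Qed.

Lemma cmod_coef_le_lev x (M : R) k : (forall z, cmod (lev z x) <= M) ->
  cmod (x k) <= M.
Proof.
move=> xM; have -> : x k = laurent_shift (- k) 1 x 0.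
  by rewrite /= mul1r sub0r opprK.
apply: cmod_coef0_le => z.
by rewrite lev_laurent_shift mul1r cmodM cmod_circleXz mul1r.
Qed.

Lemma lev_inj x y : (forall z, lev z x = lev z y) -> x = y.
Proof.
move=> xy; apply: laurentP => k; apply/eqP; rewrite -subr_eq0 -lcoefB -cmod_eq0.
rewrite eq_le cmod_ge0 andbT; apply: cmod_coef_le_lev => z.
by rewrite raddfB/= xy subrr cmod0.
Qed.

End LaurentEvaluation.

Section LaurentRing.
Variable R : realType.
Implicit Types (x y : laurent R) (z : circle R).

Definition lmul x y := lsum (fun k => laurent_shift k (x k) y).

Lemma lsummable_laurent_shift x y :
  lsummable (fun k => laurent_shift k (x k) y).
Proof.
apply: nsummable_le (nsummableZ (lnorm_ge0 y) _ (lcoef_summable x)) => k.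
  by rewrite lnorm_laurent_shift mulrC.
exact: cmod_ge0.
Qed.

Lemma lev_lmul z x y : lev z (lmul x y) = lev z x * lev z y.
Proof.
rewrite lev_lsum; last exact: lsummable_laurent_shift.
rewrite mulrC -csumZ; last exact: csummable_lev.
by congr csum; apply/funext => k; rewrite lev_laurent_shift mulrC.
Qed.

Fact lmulA : associative lmul.
Proof. by move=> x y t; apply: lev_inj => z; rewrite !lev_lmul mulrA. Qed.
Fact lmulC : commutative lmul.
Proof. by move=> x y; apply: lev_inj => z; rewrite !lev_lmul mulrC. Qed.
Fact lmul1 : left_id (lmono 0 1) lmul.
Proof.
by move=> x; apply: lev_inj => z; rewrite lev_lmul lev_mono expr0z !mul1r.
Qed.
Fact lmulDl : left_distributive lmul +%R.
Proof.
move=> x y t; apply: lev_inj => z.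
by rewrite raddfD/= !lev_lmul raddfD/= mulrDl.
Qed.
Fact lmono01_neq0 : lmono 0 1 != 0 :> laurent R.
Proof.
apply/eqP => /(congr1 (fun x : laurent R => x 0)); rewrite lcoef0 /=.
by move/eqP; rewrite oner_eq0.
Qed.

HB.instance Definition _ := GRing.Zmodule_isComNzRing.Build (laurent R)
  lmulA lmulC lmul1 lmulDl lmono01_neq0.

Fact lev_is_monoid_morphism z : monoid_morphism (lev z).
Proof. by split; [rewrite lev_mono expr0z mulr1|exact: lev_lmul]. Qed.

HB.instance Definition _ z :=
  GRing.isMonoidMorphism.Build (laurent R) R[i] (lev z)
    (lev_is_monoid_morphism z).

Lemma lcoefM x y n : (x * y) n = csum (fun k => x k * y (n - k)).
Proof. exact/lcoef_lsum/lsummable_laurent_shift. Qed.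

Lemma lnormM x y : lnorm (x * y) <= lnorm x * lnorm y.
Proof.
apply: le_trans (lnorm_lsum_le (lsummable_laurent_shift x y)) _.
rewrite mulrC -nsumZ ?lnorm_ge0//; last exact: lcoef_summable.
  by under eq_fun do rewrite lnorm_laurent_shift mulrC.
by move=> k; exact: cmod_ge0.
Qed.

End LaurentRing.

Section LaurentSequences.
Variable R : realType.
Implicit Types u : nat -> laurent R.

Lemma lsummable_tail n u : lsummable u -> lsummable (fun k => u (n + k)%N).
Proof.
apply: (nsummable_comp (@addnI n) (f := fun k => lnorm (u k))) => k.
exact: lnorm_ge0.
Qed.

Lemma lsum_tail n u : lsummable u ->
  lsum u = \sum_(k < n) u k + lsum (fun k => u (n + k)%N).
Proof.
move=> us; apply: lev_inj => z; have us' := lsummable_tail n us.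
rewrite raddfD/= raddf_sum/= !lev_lsum//; apply: csum_tail.
by apply: csummable_le us => k; exact: cmod_lev_le.
Qed.

End LaurentSequences.

(** * Neumann series and canonical factorisation *)

Section ColumnSumNorm.
Variables (R : realType) (T : Type) (h : T -> R) (n : nat).
Hypothesis h_ge0 : forall x, 0 <= h x.
Implicit Types A : 'M[T]_n.

Definition colsum_norm A : R := \big[Num.max/0]_(j < n) \sum_(i < n) h (A i j).

Lemma colsum_norm_ge0 A : 0 <= colsum_norm A.
Proof. exact: bigmax_ge_id. Qed.

Lemma colsum_norm_le A (M : R) : 0 <= M ->
  (forall j, \sum_(i < n) h (A i j) <= M) -> colsum_norm A <= M.
Proof. by move=> M0 AM; apply: bigmax_le. Qed.

Lemma col_le_colsum_norm A j : \sum_(i < n) h (A i j) <= colsum_norm A.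
Proof. exact: (le_bigmax _ (fun j => \sum_(i < n) h (A i j))). Qed.

Lemma entry_le_colsum_norm A i j : h (A i j) <= colsum_norm A.
Proof.
apply: le_trans (col_le_colsum_norm A j); rewrite (bigD1 i)//= lerDl.
exact: sumr_ge0.
Qed.

End ColumnSumNorm.

Section MatrixNorm.
Variables (R : realType) (n : nat).
Implicit Types (A B : 'M[laurent R]_n) (u : nat -> 'M[laurent R]_n).

Definition mnorm A : R := colsum_norm (@lnorm R) A.

Lemma mnorm_ge0 A : 0 <= mnorm A.
Proof. exact: colsum_norm_ge0. Qed.

Lemma mnorm_le A (M : R) : 0 <= M ->
  (forall j, \sum_(i < n) lnorm (A i j) <= M) -> mnorm A <= M.
Proof. exact: colsum_norm_le. Qed.

Lemma col_le_mnorm A j : \sum_(i < n) lnorm (A i j) <= mnorm A.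
Proof. exact: col_le_colsum_norm. Qed.

Lemma entry_le_mnorm A i j : lnorm (A i j) <= mnorm A.
Proof. exact: entry_le_colsum_norm (@lnorm_ge0 R) _ _ _. Qed.

Lemma mnorm_le0_eq0 A : mnorm A <= 0 -> A = 0.
Proof.
move=> A0; apply/matrixP => i j; rewrite mxE; apply: lnorm_le0_eq0.
exact: le_trans (entry_le_mnorm _ _ _) A0.
Qed.

Lemma mnormN A : mnorm (- A) = mnorm A.
Proof. by apply: eq_bigr => j _; apply: eq_bigr => i _; rewrite mxE lnormN. Qed.

Lemma mnormD A B : mnorm (A + B) <= mnorm A + mnorm B.
Proof.
apply: mnorm_le => [|j]; first by rewrite addr_ge0 ?mnorm_ge0.
apply: le_trans (lerD (col_le_mnorm A j) (col_le_mnorm B j)).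
by rewrite -big_split/=; apply: ler_sum => i _; rewrite mxE lnormD.
Qed.

Lemma mnormB A B : mnorm (A - B) <= mnorm A + mnorm B.
Proof. by rewrite -(mnormN B) mnormD. Qed.

Lemma mnormM A B : mnorm (A *m B) <= mnorm A * mnorm B.
Proof.
apply: mnorm_le => [|j]; first by rewrite mulr_ge0 ?mnorm_ge0.
apply: (@le_trans _ _ (\sum_i \sum_k lnorm (A i k) * lnorm (B k j))).
  apply: ler_sum => i _; rewrite mxE (le_trans (lnorm_sum _ _ _))//.
  by apply: ler_sum => k _; exact: lnormM.
rewrite exchange_big/=.
apply: (@le_trans _ _ (\sum_k mnorm A * lnorm (B k j))).
  apply: ler_sum => k _; rewrite -mulr_suml ler_wpM2r ?lnorm_ge0//.
  exact: col_le_mnorm.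
by rewrite -mulr_sumr ler_wpM2l ?mnorm_ge0// col_le_mnorm.
Qed.

Definition msummable u := nsummable (fun m => mnorm (u m)).

Definition msum u : 'M[laurent R]_n := \matrix_(i, j) lsum (fun m => u m i j).

Lemma lsummable_entry u i j : msummable u -> lsummable (fun m => u m i j).
Proof. by apply: nsummable_le => m; exact: entry_le_mnorm. Qed.

Lemma msummable_tail m u : msummable u -> msummable (fun k => u (m + k)%N).
Proof.
apply: (nsummable_comp (@addnI m) (f := fun k => mnorm (u k))) => k.
exact: mnorm_ge0.
Qed.

Lemma mnorm_msum_le u : msummable u ->
  mnorm (msum u) <= nsum (fun m => mnorm (u m)).
Proof.
move=> us; apply: mnorm_le => [|j].
  by apply: nsum_ge0 => m; exact: mnorm_ge0.
apply: (@le_trans _ _ (\sum_i nsum (fun m => lnorm (u m i j)))).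
  by apply: ler_sum => i _; rewrite mxE lnorm_lsum_le//; exact: lsummable_entry.
rewrite -nsum_sum => [|i m|i]; [|exact: lnorm_ge0|exact: lsummable_entry].
apply: le_nsum us => [m|m]; last exact: col_le_mnorm.
by apply: sumr_ge0 => i _; exact: lnorm_ge0.
Qed.

Lemma msum_tail m u : msummable u ->
  msum u = \sum_(k < m) u k + msum (fun k => u (m + k)%N).
Proof.
move=> us; apply/matrixP => i j; rewrite !mxE summxE.
exact/lsum_tail/lsummable_entry.
Qed.

Lemma msummable_bounded (K : 'M[laurent R]_n -> 'M[laurent R]_n) (C : R) u :
  0 <= C -> (forall A, mnorm (K A) <= C * mnorm A) ->
  msummable u -> msummable (fun m => K (u m)).
Proof.
move=> C0 KC us; apply: nsummable_le (nsummableZ C0 _ us) => m; first exact: KC.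
exact: mnorm_ge0.
Qed.

Lemma raddf_msum (K : {additive 'M[laurent R]_n -> 'M[laurent R]_n}) (C : R) u :
  0 <= C -> (forall A, mnorm (K A) <= C * mnorm A) -> msummable u ->
  K (msum u) = msum (fun m => K (u m)).
Proof.
move=> C0 KC us; have Kus := msummable_bounded C0 KC us.
apply/eqP; rewrite -subr_eq0; apply/eqP/mnorm_le0_eq0/ler_addgt0Pr => e e0.
have d0 : 0 < e / (C + C + 1) by rewrite divr_gt0// ltr_wpDl ?addr_ge0.
have [m um] := nsum_tail_small (fun k => mnorm_ge0 (u k)) us d0.
have us' := msummable_tail m us.
rewrite (msum_tail m us) raddfD raddf_sum (msum_tail m Kus).
rewrite opprD addrACA subrr add0r add0r (le_trans (mnormB _ _))//.
apply: (@le_trans _ _ ((C + C) * (e / (C + C + 1)))); last first.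
  by rewrite mulrCA ger_pMr// ler_pdivrMr ?mul1r ?lerDl// ltr_wpDl ?addr_ge0.
have tail_le : nsum (fun k => mnorm (u (m + k)%N)) <= e / (C + C + 1).
  exact: um.
rewrite mulrDl lerD//.
  by rewrite (le_trans (KC _))// ler_wpM2l// (le_trans (mnorm_msum_le us')).
rewrite (le_trans (mnorm_msum_le (msummable_tail m Kus)))//.
apply: le_trans (ler_wpM2l C0 tail_le); rewrite -nsumZ//; last first.
  by move=> k; exact: mnorm_ge0.
apply: le_nsum => [k|k|]; [exact: mnorm_ge0|exact: KC|].
by apply: nsummableZ => // k; exact: mnorm_ge0.
Qed.

Lemma neumann_solvable (K : {additive 'M[laurent R]_n -> 'M[laurent R]_n})
    (q : R) B :
  0 <= q -> q < 1 -> (forall A, mnorm (K A) <= q * mnorm A) ->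
  exists Y, Y + K Y = B.
Proof.
move=> q0 q1 Kq; pose u m := iter m (fun A => - K A) B.
have uq m : mnorm (u m) <= mnorm B * q ^+ m.
  elim: m => [|m ih]; first by rewrite expr0 mulr1.
  by rewrite /u iterS -/(u m) mnormN (le_trans (Kq _))// exprS mulrCA ler_wpM2l.
have us : msummable u.
  by apply: nsummable_geometric uq => // m; exact: mnorm_ge0.
exists (msum u); rewrite (raddf_msum q0 Kq us) (msum_tail 1 us) big_ord1 -addrA.
rewrite [X in B + X](_ : _ = 0) ?addr0//; apply/matrixP => i j; rewrite !mxE.
have us1 := lsummable_entry i j (msummable_tail 1 us).
have Kus := lsummable_entry i j (msummable_bounded q0 Kq us).
apply: laurentP => k; rewrite lcoefD lcoef0 !lcoef_lsum// -csumD.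
- under eq_fun do rewrite add1n /u iterS mxE lcoefN addNr.
  exact: csum0.
- exact: csummable2_row (csummable2C (csummable2_lcoef us1)).
- exact: csummable2_row (csummable2C (csummable2_lcoef Kus)).
Qed.

End MatrixNorm.

Section Supports.
Variable R : realType.
Implicit Types (S : pred int) (x y : laurent R).

Definition supp S x := forall k, ~~ S k -> x k = 0.

Lemma supp0 S : supp S 0. Proof. by move=> k _; rewrite lcoef0. Qed.

Lemma suppN S x : supp S x -> supp S (- x).
Proof. by move=> xS k Sk; rewrite lcoefN xS// oppr0. Qed.

Lemma suppD S x y : supp S x -> supp S y -> supp S (x + y).
Proof. by move=> xS yS k Sk; rewrite lcoefD xS// yS// addr0. Qed.

Lemma suppM S S' S'' x y : (forall k l, S k -> S' l -> S'' (k + l)) ->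
  supp S x -> supp S' y -> supp S'' (x * y).
Proof.
move=> SS' xS yS' m S''m; rewrite lcoefM -[RHS](csum0 R int).
congr csum; apply/funext => k.
have [Sk|/xS ->] := boolP (S k); last by rewrite mul0r.
have [Sl|/yS' ->] := boolP (S' (m - k)); last by rewrite mulr0.
by have := SS' _ _ Sk Sl; rewrite addrC subrK (negPf S''m).
Qed.

Lemma supp_mono S k (a : R[i]) : S k -> supp S (lmono k a).
Proof. by move=> Sk j /=; case: eqP => // ->; rewrite Sk. Qed.

Definition lproj S x := Laurent (csummable_if S (lcoef_summable x)).

Fact lproj_is_zmod_morphism S : zmod_morphism (lproj S).
Proof.
move=> x y; apply: laurentP => k; rewrite lcoefB /=.
by case: ifP; rewrite ?subr0.
Qed.

HB.instance Definition _ S := GRing.isZmodMorphism.Build (laurent R) (laurent R)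
  (lproj S) (lproj_is_zmod_morphism S).

Lemma supp_lproj S x : supp S (lproj S x).
Proof. by move=> k /= /negPf ->. Qed.

Lemma supp_sub_lproj S x : supp (predC S) (x - lproj S x).
Proof. by move=> k /negPn Sk; rewrite lcoefB /= Sk subrr. Qed.

Lemma lnorm_lproj_le S x : lnorm (lproj S x) <= lnorm x.
Proof.
apply: le_nsum (lcoef_summable x) => k; first exact: cmod_ge0.
by rewrite /=; case: ifP; rewrite ?cmod0 ?cmod_ge0.
Qed.

Variable n : nat.
Implicit Types A B : 'M[laurent R]_n.

Definition msupp S A := forall i j, supp S (A i j).

Lemma sub_msupp S S' A : (forall k, S k -> S' k) -> msupp S A -> msupp S' A.
Proof. by move=> SS' AS i j k; move/(contra (SS' k)) => /AS. Qed.

Lemma msuppD S A B : msupp S A -> msupp S B -> msupp S (A + B).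
Proof. by move=> AS BS i j; rewrite mxE; exact: suppD. Qed.

Lemma msuppM S S' S'' A B : (forall k l, S k -> S' l -> S'' (k + l)) ->
  msupp S A -> msupp S' B -> msupp S'' (A *m B).
Proof.
move=> SS' AS BS' i j; rewrite mxE; apply: (big_ind (supp S'')).
- exact: supp0.
- by move=> x y; exact: suppD.
- by move=> k _; exact: suppM SS' (AS i k) (BS' k j).
Qed.

Lemma msupp1 S : S 0 -> msupp S 1%:M.
Proof.
move=> S0 i j; rewrite mxE; case: eqP => _; last exact: supp0.
exact: supp_mono.
Qed.

Lemma mnorm_lproj_le S A : mnorm (map_mx (lproj S) A) <= mnorm A.
Proof.
apply: mnorm_le => [|j]; first exact: mnorm_ge0.
apply: le_trans (col_le_mnorm A j); apply: ler_sum => i _.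
by rewrite mxE lnorm_lproj_le.
Qed.

End Supports.

Definition nneg_int : pred int := fun k => 0 <= k.
Definition npos_int : pred int := fun k => k <= 0.
Definition neg_int : pred int := fun k => k < 0.

Lemma nneg_intD k l : nneg_int k -> nneg_int l -> nneg_int (k + l).
Proof. exact: addr_ge0. Qed.

Lemma npos_intD k l : npos_int k -> npos_int l -> npos_int (k + l).
Proof. by rewrite /npos_int; lia. Qed.

Lemma neg_intD k l : neg_int k -> neg_int l -> neg_int (k + l).
Proof. by rewrite /neg_int; lia. Qed.

Section CanonicalFactorisation.
Variables (R : realType) (n : nat).
Implicit Types A B X Y : 'M[laurent R]_n.

Lemma neumann_split_support (K : {additive 'M[laurent R]_n -> 'M[laurent R]_n})
    (q : R) S :
  0 <= q -> q < 1 -> (forall A, mnorm (K A) <= q * mnorm A) ->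
  exists Y, msupp S (Y - 1%:M) /\ msupp (predC S) (Y + K Y - 1%:M).
Proof.
move=> q0 q1 Kq.
have [|Y Y1] := @neumann_solvable _ _ (map_mx (lproj S) \o K) q 1%:M q0 q1.
  by move=> A; exact: le_trans (mnorm_lproj_le _ _) (Kq A).
exists Y; split=> i j.
  rewrite -Y1 opprD addrA subrr add0r 2!mxE; exact/suppN/supp_lproj.
by rewrite -Y1 opprD addrACA subrr add0r !mxE; exact: supp_sub_lproj.
Qed.

Lemma msupp_neg_unipotentM A B : msupp neg_int (A - 1%:M) ->
  msupp neg_int (B - 1%:M) -> msupp neg_int (A *m B - 1%:M).
Proof.
move=> An Bn.
have -> : A *m B - 1%:M = (A - 1%:M) *m (B - 1%:M) + ((A - 1%:M) + (B - 1%:M)).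
  rewrite mulmxBl mul1mx mulmxBr mulmx1.
  by rewrite [A - _ + _]addrC addrA subrK addrA subrK.
by apply: msuppD (msuppM neg_intD An Bn) (msuppD An Bn).
Qed.

Lemma msupp_nneg_neg_eq1 A : msupp nneg_int A -> msupp neg_int (A - 1%:M) ->
  A = 1%:M.
Proof.
move=> Ap An; apply/eqP; rewrite -subr_eq0; apply/eqP/matrixP => i j.
apply: laurentP => k; rewrite [in RHS]mxE lcoef0.
have Ap1 : msupp nneg_int (A - 1%:M).
  by apply: (msuppD Ap) => i' j'; rewrite mxE; exact/suppN/msupp1.
have [k0|k0] := boolP (neg_int k); last exact: An.
by apply: Ap1; rewrite /nneg_int -ltNge.
Qed.

Lemma canonical_factorisation X : mnorm X < 1 ->
  exists U V T Y : 'M[laurent R]_n,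
    [/\ msupp neg_int (U - 1%:M) /\ msupp neg_int (V - 1%:M),
        msupp nneg_int T /\ msupp nneg_int Y,
        U *m V = 1%:M, T *m Y = 1%:M & U *m T = 1%:M + X].
Proof.
move=> X1; have X0 := mnorm_ge0 X.
have nneg_of_unipotent A : msupp nneg_int (A - 1%:M) -> msupp nneg_int A.
  by move=> An; rewrite -(subrK 1%:M A); exact/(msuppD An)/msupp1.
have [Y [Yp XYn]] := neumann_split_support nneg_int X0 X1 (mnormM X).
have [|V [Vn VXp]] := @neumann_split_support (mulmxr X) _ neg_int X0 X1.
  by move=> A; rewrite mulrC mnormM.
pose U := (1%:M + X) *m Y; pose T := V *m (1%:M + X).
have Un : msupp neg_int (U - 1%:M).
  rewrite /U mulmxDl mul1mx; apply: sub_msupp XYn => k.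
  by rewrite /neg_int /= /nneg_int ltNge.
have {VXp} Tp : msupp nneg_int T.
  apply: nneg_of_unipotent; rewrite /T mulmxDr mulmx1.
  apply: sub_msupp VXp => k.
  by rewrite /nneg_int /= /neg_int leNgt.
have {}Yp := nneg_of_unipotent _ Yp.
have TY1 : T *m Y = 1%:M.
  apply: msupp_nneg_neg_eq1; first exact: msuppM nneg_intD Tp Yp.
  by rewrite /T -mulmxA; exact: msupp_neg_unipotentM.
exists U, V, T, Y; split=> //.
- by apply: mulmx1C; rewrite /U mulmxA.
- by rewrite /U -mulmxA (mulmx1C TY1) mulmx1.
Qed.

End CanonicalFactorisation.

(** * Cauchy estimates *)

Section PowerSeries.
Variable R : realType.
Implicit Types (e : nat -> int) (c : int -> R[i]) (s t : R[i]).

Definition power_terms e c t (k : nat) : R[i]^o := c (e k) * t ^ e k.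

Definition power_fun e c t : R[i] := limn (series (power_terms e c t)).

Lemma plus_funE c : plus_fun c = power_fun Posz c. Proof. by []. Qed.

Lemma minus_funE c : minus_fun c = power_fun negS c. Proof. by []. Qed.

Lemma cmod_power_terms e c t k :
  cmod (power_terms e c t k) = cmod (c (e k)) * cmod t ^ e k.
Proof. by rewrite cmodM cmodXz. Qed.

Lemma csummable_power_eq_cmod e c s t : cmod s = cmod t ->
  csummable (power_terms e c s) -> csummable (power_terms e c t).
Proof.
by move=> st; apply: csummable_le => k; rewrite !cmod_power_terms st.
Qed.

Lemma power_fun_csum e c t : csummable (power_terms e c t) ->
  power_fun e c t = csum (power_terms e c t).
Proof. exact: lim_series_csum. Qed.

Lemma cvg_series_cmod_bounded (a : nat -> R[i]) :
  cvgn (series (a : nat -> R[i]^o)) ->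
  exists B : R, forall k, cmod (a k) <= B.
Proof.
move=> /cvg_series_cvg_0/cvgP/cvg_seq_bounded[M [_ aM]].
exists (complex.Re (M + 1)) => k.
have M1 : M < M + 1 by rewrite ltrDl.
by have := aM _ M1 k I; rewrite /= normC_cmod lecE => /andP[].
Qed.

Lemma csummable_power_geometric e c s t (q : R) : 0 <= q -> q < 1 ->
  (forall k, cmod t ^ e k <= cmod s ^ e k * q ^+ k) ->
  cvgn (series (power_terms e c s)) -> csummable (power_terms e c t).
Proof.
move=> q0 q1 tq /cvg_series_cmod_bounded[B sB].
apply: (nsummable_geometric (A := B) q0 q1) => k; first exact: cmod_ge0.
rewrite cmod_power_terms (le_trans (ler_wpM2l (cmod_ge0 _) (tq k)))//.
by rewrite mulrA ler_wpM2r ?exprn_ge0// -cmod_power_terms.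
Qed.

Lemma analytic_plus_csummable (r2 : \bar R) c t : analytic_plus r2 c ->
  disc r2 t -> csummable (power_terms Posz c t).
Proof.
move=> ca tr2; have [r tr rr2] : exists2 r : R, cmod t < r & (r%:E < r2)%E.
  case: r2 tr2 {ca} => [r2||//]; last first.
    by move=> _; exists (cmod t + 1); rewrite ?ltry// ltrDl.
  rewrite /disc/= lte_fin => tr2.
  by exists ((cmod t + r2) / 2); rewrite ?lte_fin; lra.
have r0 : 0 < r by exact: le_lt_trans (cmod_ge0 t) tr.
have rC : cmod r%:C = r by rewrite cmod_real gtr0_norm.
apply: (csummable_power_geometric (s := r%:C) (q := cmod t / r)).
- by rewrite divr_ge0 ?cmod_ge0// ltW.
- by rewrite ltr_pdivrMr// mul1r.
- move=> k; rewrite rC -[_ ^ k]/(_ ^+ k) -[r ^ _]/(r ^+ k) -exprMn.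
  by rewrite mulrC divfK// gt_eqF.
- by apply: ca; rewrite /disc/= rC.
Qed.

Lemma analytic_minus_csummable (r1 : R) c t : analytic_minus r1 c -> 0 <= r1 ->
  exterior r1 t -> csummable (power_terms negS c t).
Proof.
move=> ca r10; rewrite /exterior/= => r1t; pose r := (r1 + cmod t) / 2.
have [r1r rt] : r1 < r /\ r < cmod t by rewrite /r; split; lra.
have r0 : 0 < r by exact: le_lt_trans r1r.
have t0 : 0 < cmod t by exact: lt_trans rt.
have rC : cmod r%:C = r by rewrite cmod_real gtr0_norm.
have q1 : r / cmod t < 1 by rewrite ltr_pdivrMr// mul1r.
have q0 : 0 <= r / cmod t by rewrite divr_ge0// ltW.
apply: (csummable_power_geometric (s := r%:C) q0 q1).
  move=> k; rewrite rC -[_ ^ negS k]/(_ ^- k.+1) -[r ^ _]/(r ^- k.+1).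
  rewrite ler_pdivlMl ?exprn_gt0// -expr_div_n exprS ler_piMl ?exprn_ge0//.
  exact: ltW.
by apply: ca; rewrite /exterior/= rC.
Qed.

Definition power_mono e c (k : nat) : laurent R := lmono (e k) (c (e k)).

Definition power_sum e c : laurent R := lsum (power_mono e c).

Definition power_partial e c n : laurent R := \sum_(k < n) power_mono e c k.

Lemma lsummable_power_mono e c : csummable (c \o e) ->
  lsummable (power_mono e c).
Proof. by apply: nsummable_le => k; rewrite lnorm_mono. Qed.

Lemma csummable_power_circle e c (z : circle R) :
  csummable (c \o e) -> csummable (power_terms e c z).
Proof.
apply: csummable_le => k.
by rewrite cmod_power_terms cmod_circle exp1rz mulr1.
Qed.

Lemma lev_power_sum e c (z : circle R) : csummable (c \o e) ->
  lev z (power_sum e c) = power_fun e c z.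
Proof.
move=> cs; rewrite lev_lsum; last exact: lsummable_power_mono.
rewrite power_fun_csum; last exact: csummable_power_circle.
by congr csum; apply/funext => k; rewrite lev_mono.
Qed.

Lemma lev_power_partial e c (z : circle R) n :
  lev z (power_partial e c n) = \sum_(k < n) power_terms e c z k.
Proof. by rewrite raddf_sum; apply: eq_bigr => k _; exact: lev_mono. Qed.

Lemma lcoef_power_sum e c k : injective e -> csummable (c \o e) ->
  power_sum e c (e k) = c (e k).
Proof.
move=> inje cs; rewrite lcoef_lsum; last exact: lsummable_power_mono.
rewrite -[RHS](csum_delta k); congr csum; apply/funext => j /=.
by rewrite (inj_eq inje) eq_sym; case: eqP => [->|].
Qed.

Lemma cauchy_estimate e c (r M : R) k : injective e -> 0 < r ->
  csummable (power_terms e c r%:C) ->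
  (forall t, cmod t = r -> cmod (power_fun e c t) <= M) ->
  cmod (c (e k)) * r ^ e k <= M.
Proof.
move=> inje r0 cs cM; pose cr j := c j * r%:C ^ j.
have rC : cmod r%:C = r by rewrite cmod_real gtr0_norm.
rewrite -rC -cmodXz -cmodM -[_ * _]/(cr (e k)) -(lcoef_power_sum k inje cs).
apply: cmod_coef_le_lev => z; rewrite lev_power_sum//.
have -> : power_fun e cr z = power_fun e c (r%:C * z).
  rewrite /power_fun (_ : power_terms e cr z = power_terms e c (r%:C * z))//.
  by apply/funext => j; rewrite /power_terms /cr -mulrA expfzMl.
by apply: cM; rewrite cmodM cmod_circle mulr1.
Qed.

Lemma cmod_power_fun_le e c s t : cmod s = cmod t ->
  csummable (power_terms e c s) ->
  cmod (power_fun e c t) <= nsum (fun k => cmod (power_terms e c s k)).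
Proof.
move=> st cs; have ct := csummable_power_eq_cmod st cs.
rewrite power_fun_csum// (le_trans (cmod_csum ct))//.
by under eq_fun do rewrite cmod_power_terms -st -cmod_power_terms.
Qed.

Lemma lev_plus_minus (z : circle R) (x : laurent R) :
  lev z x = plus_fun x z + minus_fun x z.
Proof.
have xz := csummable_lev z x; rewrite /lev csum_int//.
congr (_ + _); rewrite ?plus_funE ?minus_funE power_fun_csum//.
  exact: (csummable_comp Posz_inj xz).
exact: (csummable_comp negS_inj xz).
Qed.

End PowerSeries.

Section CircleTopology.
Variable R : realType.

Lemma cmod_continuous : continuous (@cmod R : R[i]^o -> R).
Proof.
move=> z; apply/(@cvgrPdist_lt _ _ _ _ (nbhs_filter (z : R[i]^o))) => e e0.
apply/near_cmodP; exists e => // t zt.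
exact: le_lt_trans (cmod_dist _ _) zt.
Qed.

Lemma real_complex_continuous : continuous (real_complex R : R -> R[i]^o).
Proof.
move=> x; apply/cvg_cmodP => e e0; near=> y.
rewrite -rmorphB cmod_real; near: y.
by apply/nbhs_ballP; exists e => //= y; rewrite -ball_normE.
Unshelve. all: by end_near. Qed.

Lemma Complex_continuous :
  continuous ((fun p => p.1 +i* p.2) : R * R -> R[i]^o).
Proof.
have -> : (fun p => p.1 +i* p.2) =
    (fun p => (p.1)%:C + 'i%C * (p.2)%:C) :> (R * R -> R[i]^o).
  by apply/funext => p; rewrite [LHS]complexE.
move=> p; apply: cvgD; last apply: cvgM; try exact: cvg_cst.
  by apply: continuous_comp; [exact: cvg_fst|exact: real_complex_continuous].
by apply: continuous_comp; [exact: cvg_snd|exact: real_complex_continuous].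
Qed.

Lemma circle_compact (r : R) : compact ([set t | cmod t = r] : set R[i]^o).
Proof.
pose S : set (R * R) := `[- r, r] `*` `[- r, r].
have cS : compact ((fun p => p.1 +i* p.2 : R[i]^o) @` S).
  apply: continuous_compact.
    exact/continuous_subspaceT/Complex_continuous.
  by apply: compact_setX; exact: segment_compact.
apply: (subclosed_compact _ cS).
  apply: (@preimage_closed _ _ (@cmod R : R[i]^o -> R) [set r]).
    by move=> t _; exact: cmod_continuous.
  exact: closed_eq.
move=> t /= tr; exists (complex.Re t, complex.Im t); last by case: t tr.
split; rewrite /= in_itv /= -ler_norml -tr; [exact: normr_Re_le_cmod|].
exact: normr_Im_le_cmod.
Qed.

End CircleTopology.

(* [F] stands for [zeta^'-] or [zeta^'+]: the circles [|t| = r] approach the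
   circle [|t| = zeta] from inside [D]. *)
Section BoundaryValues.
Variables (R : realType) (f g : R[i] -> R[i]) (D K : set R[i]) (zeta : R).
Variables (F : set_system R) (FF : ProperFilter F).
Hypotheses (zeta0 : 0 < zeta) (Fzeta : F --> zeta).
Hypotheses (DK : D `<=` K) (zetaK : forall t, cmod t = zeta -> K t).
Hypothesis FD : \forall r \near F, forall t, cmod t = r -> D t.
Hypothesis gK : {within (K : set R[i]^o), continuous (g : R[i]^o -> R[i]^o)}.
Hypothesis gf : forall t, D t -> g t = f t.

Let radial (r : R) (t : R[i]) : R[i] := (r / zeta)%:C * t.

Let cvg_radial (t : R[i]^o) :
  (radial p.2 p.1 : R[i]^o) @[p --> (nbhs t, F)] --> (t : R[i]^o).
Proof.
have ratio : p.2 / zeta @[p --> (nbhs t, F)] --> zeta / zeta.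
  by apply: cvgM (cvg_cst _); apply: cvg_trans Fzeta; exact: cvg_snd.
rewrite -[X in _ --> X]mul1r -[1](rmorph1 (real_complex R)).
rewrite -(divff (lt0r_neq0 zeta0)).
apply: cvgM; last exact: cvg_fst.
exact: (cvg_comp _ _ ratio (@real_complex_continuous R _)).
Qed.

Let F_gt0 : \forall r \near F, 0 < r.
Proof. exact: Fzeta (lt_nbhsr zeta0). Qed.

Let cmod_radial r t : 0 < r -> cmod t = zeta -> cmod (radial r t) = r.
Proof.
move=> r0 tz; rewrite cmodM cmod_real tz ger0_norm ?divr_ge0 ?ltW//.
by rewrite divfK ?gt_eqF.
Qed.

Let F_radial : \forall r \near F, forall t, cmod t = zeta -> D (radial r t).
Proof.
by apply: filterS2 F_gt0 FD => r r0 rD t tz; apply: rD; exact: cmod_radial.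
Qed.

Let near_radial (t : R[i]^o) (B : set R[i]^o) : nbhs t B ->
  \forall t' \near t & r \near F, B (radial r t').
Proof. exact: cvg_radial. Qed.

Lemma boundary_closure (t : R[i]^o) : cmod t = zeta ->
  closure (D : set R[i]^o) t.
Proof.
move=> tz B /near_radial[[V W] /= [Vt FW] VWB].
have [r [Dr Wr]] := filter_ex (filterI F_radial FW).
exists (radial r t); split; first exact: Dr.
by apply: (VWB (t, r)); split=> //; exact: nbhs_singleton Vt.
Qed.

Lemma extension_boundary t : cmod t = zeta -> extension f D t = g t.
Proof.
move=> tz; rewrite /extension; case: ifPn => [/[!inE] /gf //|_].
have DF : ProperFilter (within (D : set R[i]^o) (nbhs (t : R[i]^o))).
  exact/within_nbhs_proper/boundary_closure.
apply: (@cvg_lim R[i]^o (@norm_hausdorff _ _) _ _ DF).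
move/subspace_continuousP: gK => /(_ t (zetaK tz)); apply: cvg_trans => A gA.
have KA : \forall s \near (t : R[i]^o), K s -> A (g s) by exact: gA.
suff : \forall s \near (t : R[i]^o), D s -> A (f s) by exact.
by apply: filterS KA => s As Ds; rewrite -gf//; exact/As/DK.
Qed.

Let within_cmod (t : R[i]) (e : R) : K t -> 0 < e ->
  \forall s \near (t : R[i]^o), K s -> cmod (g s) < cmod (g t) + e.
Proof.
move=> Kt e0.
have gte : \forall s \near (t : R[i]^o), K s -> cmod (g t - g s) < e.
  by move/subspace_continuousP: gK => /(_ t Kt)/cvg_cmodP/(_ e e0).
apply: filterS gte => s gts /gts gtse.
have := cmod_dist (g s) (g t); rewrite cmod_distC ler_norml => /andP[_].
rewrite lerBlDl => /le_lt_trans; apply; rewrite ltrD2l; exact: gtse.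
Qed.

Lemma cmod_extension_le_circle_max t : cmod t = zeta ->
  cmod (extension f D t) <= circle_max (extension f D) zeta.
Proof.
pose C : set R[i]^o := [set t | cmod t = zeta].
have C0 : C !=set0 by exists zeta%:C; rewrite /C /= cmod_real gtr0_norm.
have gC : {within C, continuous (g : R[i]^o -> R[i]^o)}.
  by apply: continuous_subspaceW gK; exact: zetaK.
have cmod_gC : {within C, continuous (fun s => cmod (g s))}.
  by move=> s; apply: continuous_comp (gC s) _; exact: cmod_continuous.
have [s /[!inE] Cs gs] := compact_EVT_max C0 (@circle_compact R zeta) cmod_gC.
move=> tz; apply: ub_le_sup; last by exists t.
exists (cmod (g s)) => _ [t' tz' <-]; rewrite extension_boundary//.
by apply: gs; rewrite inE.
Qed.

Lemma near_circle_max e : 0 < e ->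
  \forall r \near F, forall t, cmod t = r ->
    cmod (f t) <= circle_max (extension f D) zeta + e.
Proof.
move=> e0; set M := circle_max _ _.
have : \forall r \near F, [set t | cmod t = zeta] `<=`
    [set t | K (radial r t) -> cmod (g (radial r t)) <= M + e].
  move/compact_near_coveringP/near_covering_withinP: (@circle_compact R zeta).
  apply=> t tz; apply: filterS (near_radial (within_cmod (zetaK tz) e0)).
  move=> [t' r] /= gt' _ /gt'/ltW/le_trans; apply.
  by rewrite lerD2r -extension_boundary//; exact: cmod_extension_le_circle_max.
apply: filterS3 F_gt0 FD => r r0 rD gM t tr.
have Dt := rD _ tr; have radialK : radial r ((zeta / r)%:C * t) = t.
  by rewrite /radial mulrA -rmorphM/= mulrA divfK ?divff ?mul1r ?gt_eqF.
rewrite -(gf Dt) -radialK; apply: gM; last by rewrite radialK; exact: DK.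
by rewrite /= cmodM cmod_real tr ger0_norm ?divfK ?gt_eqF// divr_ge0 ?ltW.
Qed.

Lemma coef_le_circle_max_boundary (a : R) (k : int) :
  (\forall r \near F, forall B, (forall t, cmod t = r -> cmod (f t) <= B) ->
    a * r ^ k <= B) ->
  a * zeta ^ k <= circle_max (extension f D) zeta.
Proof.
move=> Fa; apply/ler_addgt0Pr => e e0.
have ak : a * r ^ k @[r --> F] --> a * zeta ^ k.
  apply: cvgM; first exact: cvg_cst.
  apply: cvg_trans (cvg_app _ Fzeta) _.
  case: k {Fa} => n; first exact: exprn_continuous.
  by apply: cvgV; [rewrite expf_neq0 ?gt_eqF|exact: exprn_continuous].
apply: (cvgr_to_le ak); apply: filterS2 Fa (near_circle_max e0) => r ra fM.
exact: ra.
Qed.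

End BoundaryValues.

Section CoefficientBounds.
Variables (R : realType) (e : nat -> int) (c : int -> R[i]) (D : set R[i]).
Variables (zeta : R) (k : nat).
Hypotheses (inje : injective e) (zeta0 : 0 < zeta).
Hypothesis cD : forall t, D t -> csummable (power_terms e c t).

Let cauchy_on_circle (r M : R) : 0 < r -> (forall t, cmod t = r -> D t) ->
  (forall t, cmod t = r -> cmod (power_fun e c t) <= M) ->
  cmod (c (e k)) * r ^ e k <= M.
Proof.
move=> r0 rD; apply: cauchy_estimate => //.
by apply/cD/rD; rewrite cmod_real gtr0_norm.
Qed.

Lemma coef_le_circle_max_inside : (forall t, cmod t = zeta -> D t) ->
  cmod (c (e k)) * zeta ^ e k <= circle_max (extension (power_fun e c) D) zeta.
Proof.
move=> zD; have zC : cmod zeta%:C = zeta by rewrite cmod_real gtr0_norm.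
have extE t : cmod t = zeta -> extension (power_fun e c) D t = power_fun e c t.
  by move=> tz; rewrite /extension mem_set//; exact: zD.
apply: cauchy_on_circle => // t tz.
apply: ub_le_sup; last by exists t; rewrite ?extE.
exists (nsum (fun j => cmod (power_terms e c zeta%:C j))) => _ [s sz <-].
by rewrite extE// cmod_power_fun_le ?zC//; exact/cD/zD.
Qed.

Lemma coef_le_circle_max_limit (K : set R[i]) (F : set_system R) :
  ProperFilter F -> F --> zeta -> D `<=` K ->
  (forall t, cmod t = zeta -> K t) ->
  (\forall r \near F, forall t, cmod t = r -> D t) ->
  extends_continuously (power_fun e c) D K ->
  cmod (c (e k)) * zeta ^ e k <= circle_max (extension (power_fun e c) D) zeta.
Proof.
move=> FF Fzeta DK zK FD [g [gK gD]].
apply: (coef_le_circle_max_boundary FF zeta0 Fzeta DK zK FD gK gD).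
apply: filterS2 FD (Fzeta _ (lt_nbhsr zeta0)) => r rD r0 B fB.
exact: cauchy_on_circle.
Qed.

End CoefficientBounds.

Section AdmissiblePairs.
Variables (R : realType) (r1 : R) (r2 : \bar R) (alpha beta : int -> R[i]).
Variables zeta1 zeta2 : R.
Hypotheses (r1_ge0 : 0 <= r1) (r1_lt1 : r1 < 1) (r2_gt1 : (1 < r2)%E).
Hypothesis zetaA : admissible r1 r2 alpha beta zeta1 zeta2.

Lemma admissible_bounds : [/\ 0 < zeta1, zeta1 < 1 & 1 < zeta2].
Proof.
case: zetaA => zeta1A zeta2A; have z2 : 1 < zeta2.
  by case: zeta2A => [[]|[z2 _]]//; rewrite -lte_fin z2.
case: zeta1A => [/andP[r1z z1]|[-> r10 _]]; split=> //.
exact: le_lt_trans r1z.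
Qed.

Lemma coef_le_Mplus k : analytic_plus r2 alpha ->
  cmod (alpha k%:Z) * zeta2 ^+ k <= Mplus r2 alpha zeta2.
Proof.
move=> aP; have [_ _ z1] := admissible_bounds.
have z0 : 0 < zeta2 by exact: lt_trans z1.
have aD t : disc r2 t -> csummable (power_terms Posz alpha t).
  exact: analytic_plus_csummable.
case: zetaA => _ [[_ zr]|[zr ext]].
  apply: (coef_le_circle_max_inside k Posz_inj z0 aD) => t.
  by rewrite /disc /= => ->.
rewrite -zr in aD ext *.
apply: (coef_le_circle_max_limit k Posz_inj z0 aD (F := zeta2^'-)
  _ _ _ _ _ ext).
- exact: cvg_at_left_filter cvg_id.
- by move=> t; exact: ltW.
- by move=> t; rewrite /closed_disc /= => ->.
- by apply: filterS (nbhs_left_lt zeta2) => r rz t; rewrite /disc /= => ->.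
Qed.

Lemma coef_le_Mminus k : analytic_minus r1 beta ->
  cmod (beta (negS k)) * zeta1 ^ negS k <= Mminus r1 beta zeta1.
Proof.
move=> bP; have [z0 _ _] := admissible_bounds.
have bD t : exterior r1 t -> csummable (power_terms negS beta t).
  exact: analytic_minus_csummable.
case: zetaA => -[/andP[rz _] _|[zr _ ext] _].
  apply: (coef_le_circle_max_inside k negS_inj z0 bD) => t.
  by rewrite /exterior /= => ->.
rewrite -zr in bD ext *.
apply: (coef_le_circle_max_limit k negS_inj z0 bD (F := zeta1^'+)
  _ _ _ _ _ ext).
- exact: cvg_at_right_filter cvg_id.
- by move=> t; exact: ltW.
- by move=> t; rewrite /closed_exterior /= => ->.
- by apply: filterS (nbhs_right_gt zeta1) => r rz t; rewrite /exterior /= => ->.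
Qed.

End AdmissiblePairs.

Section GeometricSums.
Variables (R : realType) (u : nat -> laurent R) (A q : R).
Hypotheses (q0 : 0 <= q) (q1 : q < 1).
Hypothesis uA : forall n, lnorm (u n) <= A * q ^+ n.

Let lnorm_u_ge0 n : 0 <= lnorm (u n). Proof. exact: lnorm_ge0. Qed.

Let A_ge0 : 0 <= A.
Proof.
apply: le_trans (lnorm_u_ge0 0) _.
by rewrite (le_trans (uA 0))// expr0 mulr1.
Qed.

Lemma lsummable_geometric : lsummable u.
Proof. exact: nsummable_geometric uA. Qed.

Lemma lnorm_lsum_geometric : lnorm (lsum u) <= A / (1 - q).
Proof.
apply: le_trans (lnorm_lsum_le lsummable_geometric) _.
exact: nsum_geometric_le.
Qed.

Lemma lnorm_partial_geometric n : lnorm (\sum_(k < n) u k) <= A / (1 - q).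
Proof.
apply: (le_trans (lnorm_sum _ _ _)).
apply: (@le_trans _ _ (\sum_(k < n) A * q ^+ k)); first by apply: ler_sum.
by rewrite -(big_mkord xpredT (fun k => A * q ^+ k)) sum_geometric_le.
Qed.

Lemma lnorm_tail_geometric n :
  lnorm (lsum u - \sum_(k < n) u k) <= A * q ^+ n / (1 - q).
Proof.
have us := lsummable_geometric; rewrite (lsum_tail n us) addrC addKr.
apply: le_trans (lnorm_lsum_le (lsummable_tail n us)) _.
by apply: nsum_geometric_le => // k; rewrite -mulrA -exprD.
Qed.

End GeometricSums.

Section UnitCircleSummability.
Variable R : realType.

Lemma csummable_power_terms1 e (c : int -> R[i]) :
  csummable (power_terms e c 1) -> csummable (c \o e).
Proof.
by apply: csummable_le => k; rewrite cmod_power_terms cmod1 exp1rz mulr1.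
Qed.

Lemma csummable_plus_coef (r2 : \bar R) (alpha : int -> R[i]) : (1 < r2)%E ->
  analytic_plus r2 alpha -> csummable (alpha \o Posz).
Proof.
move=> r21 alphaA.
apply/csummable_power_terms1/(analytic_plus_csummable alphaA).
by rewrite /disc /= cmod1.
Qed.

Lemma csummable_minus_coef (r1 : R) (beta : int -> R[i]) : 0 <= r1 -> r1 < 1 ->
  analytic_minus r1 beta -> csummable (beta \o negS).
Proof.
move=> r10 r11 betaA.
apply/csummable_power_terms1/(analytic_minus_csummable betaA) => //.
by rewrite /exterior /= cmod1.
Qed.

End UnitCircleSummability.

Section TriangularProduct.
Variable R : realType.
Implicit Types (f g : laurent R) (z : circle R).

Definition laurent_a (theta : int) f g : 'M[laurent R]_2 :=
  \matrix_(i, j) (if i == 0 then if j == 0 then 1 else g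
                  else if j == 0 then f else lmono theta 1 + f * g).

Lemma map_lev_laurent_a theta f g z (F G : R[i] -> R[i]) :
  lev z f = F z -> lev z g = G z ->
  map_mx (lev z) (laurent_a theta f g) = matrix_a theta F G z.
Proof.
move=> fF gG; apply/matrixP => i j; rewrite !mxE.
by case: (i == 0); case: (j == 0); rewrite ?rmorph1 ?rmorphD ?rmorphM/= ?fF ?gG
  ?lev_mono ?mul1r.
Qed.

Definition symbol theta (alpha beta : int -> R[i]) :=
  laurent_a theta (power_sum Posz alpha) (power_sum negS beta).

Definition symbol_trunc theta (alpha beta : int -> R[i]) N :=
  laurent_a theta (power_partial Posz alpha N.+1) (power_partial negS beta N).

Lemma map_lev_symbol theta (alpha beta : int -> R[i]) z :
  csummable (alpha \o Posz) -> csummable (beta \o negS) ->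
  map_mx (lev z) (symbol theta alpha beta) =
  matrix_a theta (plus_fun alpha) (minus_fun beta) z.
Proof.
by move=> alphas betas; apply: map_lev_laurent_a; exact: lev_power_sum.
Qed.

Lemma map_lev_symbol_trunc theta (alpha beta : int -> R[i]) N z :
  map_mx (lev z) (symbol_trunc theta alpha beta N) =
  matrix_a theta (plus_trunc N alpha) (minus_trunc N beta) z.
Proof. by apply: map_lev_laurent_a; exact: lev_power_partial. Qed.

Lemma mnorm_laurent_aB theta f g f' g' :
  mnorm (laurent_a theta f g - laurent_a theta f' g') <=
  (1 + lnorm f) * lnorm (g - g') + (1 + lnorm g') * lnorm (f - f').
Proof.
have [f0 g0] := (lnorm_ge0 (f - f'), lnorm_ge0 (g - g')).
have fg : lnorm (lmono theta 1 + f * g - (lmono theta 1 + f' * g')) <=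
    lnorm f * lnorm (g - g') + lnorm g' * lnorm (f - f').
  have -> : lmono theta 1 + f * g - (lmono theta 1 + f' * g') =
      f * (g - g') + g' * (f - f') by ring.
  by rewrite (le_trans (lnormD _ _))// lerD// lnormM.
have fg0 : 0 <= lnorm f * lnorm (g - g') by rewrite mulr_ge0// lnorm_ge0.
have gf0 : 0 <= lnorm g' * lnorm (f - f') by rewrite mulr_ge0// lnorm_ge0.
apply: mnorm_le => [|j].
  by rewrite addr_ge0// mulr_ge0// addr_ge0// lnorm_ge0.
rewrite !big_ord_recl big_ord0 !mxE /=.
by case: (j == 0); rewrite ?subrr ?lnorm0; lra.
Qed.

End TriangularProduct.

Section TruncationError.
Variables (R : realType) (alpha beta : int -> R[i]) (zeta1 zeta2 Mp Mm : R).
Hypotheses (zeta1_gt0 : 0 < zeta1) (zeta1_lt1 : zeta1 < 1).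
Hypothesis zeta2_gt1 : 1 < zeta2.
Hypothesis alphaM : forall k : nat, cmod (alpha k%:Z) * zeta2 ^+ k <= Mp.
Hypothesis betaM : forall k : nat, cmod (beta (negS k)) * zeta1 ^ negS k <= Mm.

Let alpha_geometric k : lnorm (power_mono Posz alpha k) <= Mp * zeta2^-1 ^+ k.
Proof.
rewrite lnorm_mono exprVn ler_pdivlMr ?exprn_gt0//.
exact: lt_trans zeta2_gt1.
Qed.

Let beta_geometric k :
  lnorm (power_mono negS beta k) <= zeta1 * Mm * zeta1 ^+ k.
Proof.
by rewrite lnorm_mono mulrAC -exprS mulrC -ler_pdivrMr ?exprn_gt0.
Qed.

Lemma mnorm_symbol_truncation_le theta N :
  mnorm (symbol theta alpha beta - symbol_trunc theta alpha beta N) <=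
  (1 + zeta2 * Mp / (zeta2 - 1)) * (zeta1 ^+ N.+1 * Mm / (1 - zeta1))
  + (1 + zeta1 * Mm / (1 - zeta1)) * (Mp / (zeta2 ^+ N * (zeta2 - 1))).
Proof.
have zeta2_gt0 : 0 < zeta2 by exact: lt_trans zeta2_gt1.
have zeta2V_ge0 : 0 <= zeta2^-1 by rewrite invr_ge0 ltW.
have zeta2V_lt1 : zeta2^-1 < 1 by rewrite invf_lt1.
have zeta2B : zeta2 - 1 != 0 by rewrite subr_eq0 gt_eqF.
have lnorm_alpha : lnorm (power_sum Posz alpha) <= zeta2 * Mp / (zeta2 - 1).
  rewrite (_ : zeta2 * _ / _ = Mp / (1 - zeta2^-1)).
    exact: lnorm_lsum_geometric alpha_geometric.
  by field; rewrite zeta2B gt_eqF.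
have lnorm_alphaB :
    lnorm (power_sum Posz alpha - power_partial Posz alpha N.+1) <=
    Mp / (zeta2 ^+ N * (zeta2 - 1)).
  rewrite (_ : Mp / _ = Mp * zeta2^-1 ^+ N.+1 / (1 - zeta2^-1)).
    exact: lnorm_tail_geometric.
  by rewrite exprVn exprS; field; rewrite zeta2B expf_neq0 ?gt_eqF.
have lnorm_betaN :
    lnorm (power_partial negS beta N) <= zeta1 * Mm / (1 - zeta1).
  exact: lnorm_partial_geometric (ltW zeta1_gt0) zeta1_lt1 beta_geometric N.
have lnorm_betaB : lnorm (power_sum negS beta - power_partial negS beta N) <=
    zeta1 ^+ N.+1 * Mm / (1 - zeta1).
  rewrite exprS [zeta1 * _ * Mm]mulrAC.
  by apply: lnorm_tail_geometric => //; exact: ltW.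
apply: le_trans (mnorm_laurent_aB _ _ _ _ _) _.
by apply: lerD; apply: ler_pM; rewrite ?lerD2l ?addr_ge0 ?lnorm_ge0.
Qed.

End TruncationError.

Lemma mnorm_symbol_truncation_le_delta (R : realType) (theta : int) (r1 : R)
    (r2 : \bar R) (alpha beta : int -> R[i]) (N : nat) (zeta1 zeta2 : R) :
  0 <= r1 -> r1 < 1 -> (1 < r2)%E ->
  analytic_plus r2 alpha -> analytic_minus r1 beta ->
  admissible r1 r2 alpha beta zeta1 zeta2 ->
  mnorm (symbol theta alpha beta - symbol_trunc theta alpha beta N) <=
  delta r1 r2 alpha beta N zeta1 zeta2.
Proof.
move=> r10 r11 r21 alphaA betaA zetaA.
have [z10 z11 z21] := admissible_bounds r10 r11 r21 zetaA.
apply: mnorm_symbol_truncation_le => // k; first exact: coef_le_Mplus zetaA _ _.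
exact: coef_le_Mminus zetaA _ _.
Qed.

(** * Wiener-Hopf factorisation *)

Section DiagonalFactor.
Variables (R : realType) (n : nat).
Implicit Types (rho : 'I_n -> int) (U : 'M[laurent R]_n).

Definition laurent_diag rho : 'M[laurent R]_n :=
  diag_mx (\row_i lmono (rho i) 1).

Lemma laurent_diagM rho :
  laurent_diag rho *m laurent_diag (fun i => - rho i) = 1%:M.
Proof.
apply/matrixP => i j; rewrite mul_diag_mx !mxE.
have [->|ij] := eqVneq i j; last by rewrite mulr0n mulr0 mulr0n.
rewrite !mulr1n; apply: lev_inj => z.
rewrite rmorphM rmorph1/= !lev_mono !mul1r.
by rewrite -expfzDr ?circle_neq0// subrr.
Qed.

Lemma mnorm_laurent_diag_le1 rho : mnorm (laurent_diag rho) <= 1.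
Proof.
apply: mnorm_le => // j; rewrite (bigD1 j)//= big1 => [|i ij].
  by rewrite !mxE eqxx mulr1n lnorm_mono cmod1 addr0.
by rewrite !mxE (negPf ij) mulr0n lnorm0.
Qed.

(* Conjugation shifts the indices of the entry (i, j) of [U - 1], which are all
   negative, by [rho i - rho j], hence by at most one. *)
Lemma msupp_conj_laurent_diag rho U : (forall i j, rho i - rho j <= 1) ->
  msupp neg_int (U - 1%:M) ->
  msupp npos_int (laurent_diag rho *m U *m laurent_diag (fun i => - rho i)).
Proof.
move=> rho1 Un; have -> : U = (U - 1%:M) + 1%:M by rewrite subrK.
rewrite mulmxDr mulmxDl mulmx1 laurent_diagM; apply: msuppD; last exact: msupp1.
move=> i j; rewrite mul_mx_diag mul_diag_mx.
rewrite mxE [X in _ * X]mxE mxE [X in X * _ * _]mxE.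
have mono (k : int) := @supp_mono R (pred1 k) k 1 (eqxx k).
apply: (suppM (S := [pred k | k < rho i]) _ _ (mono (- rho j))).
  by move=> k l /= kl /eqP ->; have := rho1 i j; rewrite /npos_int; lia.
apply: (suppM _ (mono (rho i)) (Un i j)) => k l /eqP -> /=.
by rewrite /neg_int; lia.
Qed.

End DiagonalFactor.

Lemma mulmx_perturbation (K : pzRingType) (n : nat) (A A' L L' M M' : 'M[K]_n) :
  A = L *m M -> L *m L' = 1%:M -> M' *m M = 1%:M ->
  A' = L *m (1%:M + L' *m (A' - A) *m M') *m M.
Proof.
move=> AE LL' M'M; rewrite mulmxDr mulmxDl mulmx1 -AE -!mulmxA M'M mulmx1.
by rewrite mulmxA LL' mul1mx addrC subrK.
Qed.

Lemma mulmx_conj_split (K : pzRingType) (n : nat) (L M D D' U T : 'M[K]_n) :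
  D' *m D = 1%:M ->
  L *m D *m (U *m T) *m M = L *m (D *m U *m D') *m D *m (T *m M).
Proof. by move=> D'D; rewrite !mulmxA -(mulmxA _ D' D) D'D mulmx1. Qed.

Section WienerHopf.
Variables (R : realType) (n : nat).
Implicit Types (A B : 'M[laurent R]_n) (S : pred int) (rho : 'I_n -> int).

Definition invertible_in S A :=
  msupp S A /\ exists2 B, msupp S B & A *m B = 1%:M.

Lemma invertible_inM S A B : (forall k l, S k -> S l -> S (k + l)) ->
  invertible_in S A -> invertible_in S B -> invertible_in S (A *m B).
Proof.
move=> SD [AS [A' A'S AA']] [BS [B' B'S BB']]; split.
  exact: msuppM SD AS BS.
exists (B' *m A'); first exact: msuppM SD B'S A'S.
by rewrite mulmxA -(mulmxA A) BB' mulmx1.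
Qed.

Definition laurent_factorisation rho A Am Ap :=
  [/\ invertible_in npos_int Am, invertible_in nneg_int Ap &
      A = Am *m laurent_diag R rho *m Ap].

Lemma laurent_factorisation_perturbation rho A A' Am Ap Bm Bp :
  (forall i j, rho i - rho j <= 1) -> laurent_factorisation rho A Am Ap ->
  Am *m Bm = 1%:M -> Ap *m Bp = 1%:M ->
  mnorm Bm * mnorm (A' - A) * mnorm Bp < 1 ->
  exists Am' Ap', laurent_factorisation rho A' Am' Ap'.
Proof.
move=> rho1 [Am_npos Ap_nneg AE] AmBm ApBp lt1.
set D := laurent_diag R rho in AE; pose D' := laurent_diag R (fun i => - rho i).
have DD' : D *m D' = 1%:M by exact: laurent_diagM.
have D'D := mulmx1C DD'; have BpAp := mulmx1C ApBp.
have AmDK : (Am *m D) *m (D' *m Bm) = 1%:M.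
  by rewrite -mulmxA (mulmxA D) DD' mul1mx.
have X1 : mnorm (D' *m Bm *m (A' - A) *m Bp) < 1.
  apply: le_lt_trans lt1; apply: le_trans (mnormM _ _) _.
  rewrite ler_wpM2r ?mnorm_ge0// (le_trans (mnormM _ _))//.
  rewrite ler_wpM2r ?mnorm_ge0// (le_trans (mnormM _ _))//.
  rewrite ler_piMl ?mnorm_ge0//.
  exact: mnorm_laurent_diag_le1.
have [U [V [T [Y [[Un Vn] [Tp Yp] UV TY UT]]]]] := canonical_factorisation X1.
exists (Am *m (D *m U *m D')), (T *m Ap); split.
- apply: invertible_inM npos_intD Am_npos _.
  split; first exact: msupp_conj_laurent_diag.
  exists (D *m V *m D'); first exact: msupp_conj_laurent_diag.
  by rewrite -!mulmxA (mulmxA D' D) D'D mul1mx (mulmxA U V) UV mul1mx.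
- by apply: invertible_inM nneg_intD _ Ap_nneg; split=> //; exists Y.
rewrite [LHS](mulmx_perturbation A' AE AmDK BpAp) -UT.
exact: (mulmx_conj_split Am Ap U T D'D).
Qed.

End WienerHopf.

Section WienerMatrices.
Variables (R : realType) (p : nat).
Implicit Types (A B : wiener R p) (M N : 'M[laurent R]_p) (S : pred int).

Lemma map_lev_inj M N :
  (forall z : circle R, map_mx (lev z) M = map_mx (lev z) N) -> M = N.
Proof.
move=> MN; apply/matrixP => i j; apply: lev_inj => z.
by have /matrixP/(_ i j) := MN z; rewrite !mxE.
Qed.

Lemma norm1E (C : 'M[R[i]]_p) : norm1 C = colsum_norm (@cmod R) C.
Proof. by []. Qed.

Fact wcoef_entry_summable A i j : csummable (fun k => wcoef A k i j).
Proof.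
apply: csummable_le (wcoef_summable A) => k.
by rewrite norm1E entry_le_colsum_norm//; exact: cmod_ge0.
Qed.

Definition laurent_mx A : 'M[laurent R]_p :=
  \matrix_(i, j) Laurent (wcoef_entry_summable A i j).

Lemma map_lev_laurent_mx A (z : circle R) :
  map_mx (lev z) (laurent_mx A) = weval A z.
Proof. by apply/matrixP => i j; rewrite !mxE lev_plus_minus. Qed.

Lemma mnorm_laurent_mx_le A : mnorm (laurent_mx A) <= wnorm A.
Proof.
have As : nsummable (fun k => norm1 (wcoef A k)) := wcoef_summable A.
apply: mnorm_le => [|j].
  by apply: nsum_ge0 => k; rewrite norm1E colsum_norm_ge0.
under eq_bigr do rewrite mxE /lnorm/=.
rewrite -nsum_sum => [|i k|i]; [|exact: cmod_ge0|exact: wcoef_entry_summable].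
apply: le_nsum As => k; last exact: col_le_colsum_norm.
by apply: sumr_ge0 => i _; exact: cmod_ge0.
Qed.

Fact coef_norm_lcoef M : (coef_norm (fun k => \matrix_(i, j) M i j k) < +oo)%E.
Proof.
have Ms : nsummable (fun k => \sum_(j < p) \sum_(i < p) cmod (M i j k)).
  apply: nsummable_sum => [j k|j].
    by apply: sumr_ge0 => i _; exact: cmod_ge0.
  by apply: nsummable_sum => [i k|i]; [exact: cmod_ge0|exact: lcoef_summable].
apply: nsummable_le Ms => k; have col_ge0 j : 0 <= \sum_(i < p) cmod (M i j k).
  by apply: sumr_ge0 => i _; exact: cmod_ge0.
apply: bigmax_le => [|j _]; first exact: sumr_ge0.
under eq_bigr do rewrite mxE; rewrite [leRHS](bigD1 j)//= lerDl.
exact: sumr_ge0.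
Qed.

Definition wiener_of M : wiener R p := Wiener (coef_norm_lcoef M).

Lemma laurent_mxK M : laurent_mx (wiener_of M) = M.
Proof.
by apply/matrixP => i j; rewrite mxE; apply: laurentP => k /=; rewrite mxE.
Qed.

Lemma winverse_laurent_mx A B :
  winverse A B <-> laurent_mx A *m laurent_mx B = 1%:M.
Proof.
split=> [AB|AB t t1].
  apply: map_lev_inj => z; rewrite map_mxM map_mx1 !map_lev_laurent_mx.
  exact/AB/cmod_circle.
by rewrite -!(map_lev_laurent_mx _ (Circle t1)) -map_mxM AB map_mx1.
Qed.

Lemma msupp_laurent_mx S A :
  msupp S (laurent_mx A) <-> forall k, ~~ S k -> wcoef A k = 0.
Proof.
split=> AS k => [Sk|j l Sl]; last by rewrite mxE /= AS// mxE.
by apply/matrixP => i j; rewrite mxE; have := AS i j k Sk; rewrite mxE.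
Qed.

Lemma wplusP A : wplus A <-> msupp nneg_int (laurent_mx A).
Proof.
rewrite msupp_laurent_mx /nneg_int.
by split=> A0 k; have := A0 k; rewrite -ltNge.
Qed.

Lemma wminusP A : wminus A <-> msupp npos_int (laurent_mx A).
Proof.
rewrite msupp_laurent_mx /npos_int.
by split=> A0 k; have := A0 k; rewrite -ltNge.
Qed.

Lemma invertible_in_laurent_mx S A : invertible_in S (laurent_mx A) <->
  msupp S (laurent_mx A) /\ exists2 B, msupp S (laurent_mx B) & winverse A B.
Proof.
split=> -[AS [B BS AB]]; split=> //.
  exists (wiener_of B); first by rewrite laurent_mxK.
  by apply/winverse_laurent_mx; rewrite laurent_mxK.
by exists (laurent_mx B) => //; exact/winverse_laurent_mx.
Qed.

End WienerMatrices.

Section PartialIndices.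
Variables (R : realType) (rho1 rho2 : int).

Definition index_pair (i : 'I_2) : int := if i == 0 then rho1 else rho2.

Lemma index_pairB_le1 : rho1 <= rho2 -> stable rho1 rho2 ->
  forall i j, index_pair i - index_pair j <= 1.
Proof.
rewrite /stable /index_pair => r12 st i j.
by case: eqP; case: eqP; lia.
Qed.

Lemma map_lev_laurent_diag (z : circle R) :
  map_mx (lev z) (laurent_diag R index_pair) = dr rho1 rho2 z.
Proof.
apply/matrixP => i j; rewrite !mxE rmorphMn/= lev_mono mul1r /index_pair.
by case: i j => [[|[|i]] hi] [[|[|j]] hj].
Qed.

Lemma wh_factorisation_laurent (a : R[i] -> 'M[R[i]]_2) A am ap :
  (forall z : circle R, a z = map_mx (lev z) A) ->
  wh_factorisation a am rho1 rho2 ap <->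
  rho1 <= rho2 /\
  laurent_factorisation index_pair A (laurent_mx am) (laurent_mx ap).
Proof.
move=> aA; split.
  case=> -[/wminusP am_npos [bm /wminusP bm_npos ambm]].
  case=> /wplusP ap_nneg [bp /wplusP bp_nneg apbp] r12 aE; split=> //; split.
  - by apply/invertible_in_laurent_mx; split=> //; exists bm.
  - by apply/invertible_in_laurent_mx; split=> //; exists bp.
  apply: map_lev_inj => z; rewrite -aA !map_mxM map_lev_laurent_diag.
  by rewrite !map_lev_laurent_mx; exact/aE/cmod_circle.
case=> r12 [/invertible_in_laurent_mx[am_npos [bm bm_npos ambm]]].
move=> /invertible_in_laurent_mx[ap_nneg [bp bp_nneg apbp]] AE; split=> //.
- by split; [exact/wminusP|exists bm => //; exact/wminusP].
- by split; [exact/wplusP|exists bp => //; exact/wplusP].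
move=> t t1; have := aA (Circle t1); rewrite AE !map_mxM map_lev_laurent_diag.
by rewrite !map_lev_laurent_mx.
Qed.

End PartialIndices.

Lemma sigma_ge1 (R : realType) (rho1 rho2 : int) : 1 <= sigma R rho1 rho2.
Proof. by rewrite sigmaE; case: ifP => // _; rewrite ler1n. Qed.

Lemma mnorm_product_le_sigma (R : realType) (rho1 rho2 : int) (p : nat)
    (A B : wiener R p) (d e : R) : 0 <= e -> e <= d ->
  mnorm (laurent_mx A) * e * mnorm (laurent_mx B) <=
  sigma R rho1 rho2 * d * wnorm B * wnorm A.
Proof.
move=> e0 ed; have d0 : 0 <= d by exact: le_trans ed.
have [lA lB] := (mnorm_laurent_mx_le A, mnorm_laurent_mx_le B).
have [wA wB] := (le_trans (mnorm_ge0 _) lA, le_trans (mnorm_ge0 _) lB).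
apply: (@le_trans _ _ (wnorm A * d * wnorm B)).
  by rewrite !ler_pM ?mulr_ge0 ?mnorm_ge0.
have -> : sigma R rho1 rho2 * d * wnorm B * wnorm A =
    sigma R rho1 rho2 * (wnorm A * d * wnorm B) by ring.
by rewrite ler_peMl ?sigma_ge1// !mulr_ge0.
Qed.

Unset Implicit Arguments.

Theorem theorem4p2 (R : realType) (theta : int) (r1 : R) (r2 : \bar R)
  (alpha beta : int -> R[i])
  (r1_ge0 : 0 <= r1) (r1_lt1 : r1 < 1) (r2_gt1 : (1 < r2)%E)
  (alpha_analytic : analytic_plus r2 alpha)
  (beta_analytic : analytic_minus r1 beta)
  (N : nat) (zeta1 zeta2 : R)
  (zeta_admissible : admissible r1 r2 alpha beta zeta1 zeta2)
  (P : 'M[R[i]]_2) (hP : P = 1%:M \/ P = J2 R)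
  (rho1 rho2 : int) (aNm aNp aNm_inv aNp_inv : wiener R 2)
  (aN_factorisation :
     wh_factorisation (matrix_a theta (plus_trunc N alpha) (minus_trunc N beta))
                      aNm rho1 rho2 aNp)
  (aN_stable : stable rho1 rho2)
  (aN_normalised : normalised P rho1 rho2 aNm)
  (aNm_invP : winverse aNm aNm_inv) (aNp_invP : winverse aNp aNp_inv)
  (q_lt1 : sigma R rho1 rho2 * delta r1 r2 alpha beta N zeta1 zeta2
           * wnorm aNp_inv * wnorm aNm_inv < 1) :
  exists am ap : wiener R 2,
    wh_factorisation (matrix_a theta (plus_fun alpha) (minus_fun beta))
                     am rho1 rho2 ap
    /\ stable rho1 rho2.
Proof.
pose a := symbol theta alpha beta; pose aN := symbol_trunc theta alpha beta N.
have aE (z : circle R) :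
    matrix_a theta (plus_fun alpha) (minus_fun beta) z = map_mx (lev z) a.
  rewrite map_lev_symbol//; first exact: csummable_plus_coef alpha_analytic.
  exact: csummable_minus_coef beta_analytic.
have aNE (z : circle R) : matrix_a theta (plus_trunc N alpha)
    (minus_trunc N beta) z = map_mx (lev z) aN.
  by rewrite map_lev_symbol_trunc.
have a_aN : mnorm (a - aN) <= delta r1 r2 alpha beta N zeta1 zeta2.
  exact: mnorm_symbol_truncation_le_delta.
have [r12 aN_fact] := (wh_factorisation_laurent _ _ _ _ aNE).1 aN_factorisation.
have [am [ap a_fact]] :
    exists am ap, laurent_factorisation (index_pair rho1 rho2) a am ap.
  apply: (laurent_factorisation_perturbation (index_pairB_le1 r12 aN_stable)
    aN_fact ((winverse_laurent_mx _ _).1 aNm_invP)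
    ((winverse_laurent_mx _ _).1 aNp_invP)).
  apply: le_lt_trans q_lt1; exact: mnorm_product_le_sigma (mnorm_ge0 _) a_aN.
exists (wiener_of am), (wiener_of ap); split=> //.
by apply/(wh_factorisation_laurent _ _ _ _ aE); rewrite !laurent_mxK.
Qed.
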